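(* Let $\Phi$ be a strictly pure $\mathbf{t}$-module of $\tau$-degree $n>1$ and dimension $d$ with no nilpotence, and let $\Phi^\vee$ be its dual. Then $\Phi^{\vee\vee}:=(\Phi^\vee)^\vee\cong\Phi$ as $\mathbf{t}$-modules, and there is a short exact sequence of $\mathbf{t}$-modules $$0\to\Phi\to\operatorname{Ext}^1_\tau(\Phi^\vee,C)\to\mathbb{G}_a^{(n-1)d}\to0,$$ where $\operatorname{Ext}^1_\tau(\Phi^\vee,C)$ carries a natural $\mathbf{t}$-module structure of dimension $n\cdot d$.
   Context: Let $q$ be a prime power, $A=\mathbb{F}_q[t]$, $L$ a field with an $\mathbb{F}_q$-algebra homomorphism $\iota:A\to L$, $\theta=\iota(t)$; $L\{\tau\}$ is the twisted polynomial ring with $\tau c=c^q\tau$. A $\mathbf{t}$-module of dimension $m$ is an $\mathbb{F}_q$-algebra homomorphism $\Phi:A\to\mathrm{Mat}_m(L\{\tau\})$ with $\Phi_t=(\theta I_m+N)+M_1\tau+\dots+M_r\tau^r$, $N$ nilpotent; ''no nilpotence'' means $N=0$, ''strictly pure'' means the leading coefficient $M_r$ is invertible; $\deg_\tau\Phi=\deg_\tau\Phi_t$. Morphisms $\Phi\to\Psi$ ($\dim\Phi=m$, $\dim\Psi=e$) are $f\in\mathrm{Mat}_{e\times m}(L\{\tau\})$ with $f\Phi_t=\Psi_tf$. $\mathbb{G}_a^k$ is the $\mathbf{t}$-module $t\mapsto\theta I_k$; $C$ is the Carlitz module $C_t=\theta+\tau$. Biderivations $\mathrm{Der}(\Phi,C)$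 are identified with $\mathrm{Mat}_{1\times m}(L\{\tau\})$ via $\delta\mapsto\delta(t)$; inner ones are $\delta^{(U)}(t)=U\Phi_t-C_tU$; $\operatorname{Ext}^1_\tau(\Phi,C)=\mathrm{Der}/\mathrm{Der}_{in}$ with $\mathbb{F}_q[t]$-action $a*\delta=C_a\delta$; $\mathrm{Der}_0,\mathrm{Der}_{0,in}$ are those with zero constant term at $t$, $\operatorname{Ext}^1_{0,\tau}(\Phi,C)=\mathrm{Der}_0/\mathrm{Der}_{0,in}$, and the dual is $\Phi^\vee=\operatorname{Ext}^1_{0,\tau}(\Phi,C)$, which for $\Phi$ as in the claim is a $\mathbf{t}$-module of dimension $d(n-1)$ and $\tau$-degree $2$. An $\mathbb{F}_q[t]$-module has a $\mathbf{t}$-module structure of dimension $k$ if it is identified $\mathbb{F}_q$-linearly with $L^k$ so that $t$ acts through a $\mathbf{t}$-module. *)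

(* Defs.v *)
From HB Require Import structures.
From mathcomp Require Import all_boot all_order all_fingroup all_algebra.
From mathcomp Require Import all_solvable all_field.

Set Implicit Arguments.
Unset Strict Implicit.
Unset Printing Implicit Defensive.

Import GRing.Theory.
Local Open Scope ring_scope.

(* The twisted polynomial ring R{tau}, tau c = c^q tau, over a commutative
   F_q-algebra R. Here q = #|Fq| and the F_q-algebra structure of R is the ring
   morphism j. The underlying additive group is {poly R}, sum_i c_i tau^i being
   represented by sum_i c_i 'X^i (coefficients on the left). *)
Section TwistedPolynomials.

Variables (Fq : finFieldType) (R : comNzRingType) (j : {rmorphism Fq -> R}).
Local Notation q := #|Fq|.

Definition tpoly of {rmorphism Fq -> R} : Type := {poly R}.

Local Notation "R{tau}" := (tpoly j).

HB.instance Definition _ := GRing.Zmodule.on R{tau}.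

Definition coeft (p : R{tau}) (i : nat) : R := (p : {poly R})`_i.
Definition sizet (p : R{tau}) : nat := size (p : {poly R}).
Definition tconst (c : R) : R{tau} := c%:P.
Definition tau : R{tau} := 'X.

Definition mult (p r : R{tau}) : R{tau} :=
  \poly_(i < (sizet p + sizet r).-1)
     \sum_(k < i.+1) coeft p k * coeft r (i - k) ^+ (q ^ k).

Lemma frobD (i : nat) (x y : R) :
  (x + y) ^+ (q ^ i) = x ^+ (q ^ i) + y ^+ (q ^ i).
Proof.
apply: exprDn_pchar; have [p pr_p charFp] := finPcharP Fq.
have charRp : p \in [pchar R] by rewrite (fmorph_pchar j).
rewrite (eq_pnat _ (pcharf_eq charRp)) pnatX; apply/orP; left.
have := abelem_pgroup (fin_ring_pchar_abelem charFp).
by rewrite /pgroup cardsT.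
Qed.

Lemma frob0 (i : nat) : (0 : R) ^+ (q ^ i) = 0.
Proof.
by rewrite expr0n gtn_eqF // expn_gt0 (ltn_trans _ (finNzRing_gt1 Fq)).
Qed.

Lemma frob_sum (i : nat) (I : Type) (r : seq I) (P : pred I) (F : I -> R) :
  (\sum_(k <- r | P k) F k) ^+ (q ^ i) = \sum_(k <- r | P k) F k ^+ (q ^ i).
Proof.
by apply: (big_morph (fun x => x ^+ (q ^ i)) (frobD i) (frob0 i)).
Qed.

Lemma frob_j (i : nat) (a : Fq) : j a ^+ (q ^ i) = j a.
Proof.
elim: i => [|i IHi]; first by rewrite expr1.
by rewrite expnSr exprM IHi -rmorphXn expf_card.
Qed.

Lemma coeft_mult (p r : R{tau}) (i : nat) :
  coeft (mult p r) i =
  \sum_(k < i.+1) coeft p k * coeft r (i - k) ^+ (q ^ k).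
Proof.
rewrite /coeft /mult coef_poly ltn_predRL; case: leqP => // le_pq_i1.
rewrite big1 // => k _; have [lq_p_k|lt_k_p] := leqP (sizet p) k.
  by rewrite nth_default ?mul0r.
rewrite [r`__]nth_default ?frob0 ?mulr0 // leq_subRL -ltnS //.
by rewrite (leq_trans _ le_pq_i1) // ltn_add2r.
Qed.

Lemma coeft_mult_rev (p r : R{tau}) (i : nat) :
  coeft (mult p r) i =
  \sum_(k < i.+1) coeft p (i - k) * coeft r k ^+ (q ^ (i - k)).
Proof.
rewrite coeft_mult (reindex_inj rev_ord_inj) /=.
by apply: eq_bigr => k _; rewrite (sub_ordK k).
Qed.

Lemma tpolyP (p r : R{tau}) : (forall i, coeft p i = coeft r i) -> p = r.
Proof. by move=> eq_pr; apply/polyP. Qed.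

Lemma coeftD (p r : R{tau}) (i : nat) :
  coeft (p + r) i = coeft p i + coeft r i.
Proof. exact: (coefD (p : {poly R})). Qed.

Lemma coeft_const (c : R) (i : nat) :
  coeft (tconst c) i = if i == 0%N then c else 0.
Proof. exact: coefC. Qed.

Fact multA : associative mult.
Proof.
move=> p r s; apply: tpolyP => i; rewrite coeft_mult coeft_mult_rev.
pose coef3 a b := coeft p a *
  (coeft r (i - a - b) ^+ (q ^ a) * coeft s b ^+ (q ^ (i - b))).
transitivity (\sum_(a < i.+1) \sum_(b < i.+1 | (b <= i - a)%N) coef3 a b).
  apply: eq_bigr => /= a _; rewrite coeft_mult_rev frob_sum big_distrr /=.
  rewrite (big_ord_narrow_leq (leq_subr _ _)); apply: eq_bigr => b _ /=.
  rewrite /coef3 exprMn -exprM -expnD; congr (_ * (_ * _ ^+ (q ^ _))).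
  have lab : (b <= i - a)%N by rewrite -ltnS.
  have lai : (a <= i)%N by rewrite -ltnS.
  by rewrite addnC addnBA // subnKC.
rewrite (exchange_big_dep predT) //=; apply: eq_bigr => b _.
transitivity (\sum_(a < i.+1 | (a <= i - b)%N) coef3 a b).
  apply: eq_bigl => a; rewrite -ltnS -(ltnS a) -!subSn ?leq_ord //.
  by rewrite -subn_gt0 -(subn_gt0 a) -!subnDA addnC.
rewrite (big_ord_narrow_leq (leq_subr _ _)) coeft_mult big_distrl /=.
by apply: eq_bigr => a _; rewrite /coef3 -!subnDA addnC mulrA.
Qed.

Fact mult1l : left_id (tconst 1) mult.
Proof.
move=> p; apply: tpolyP => i; rewrite coeft_mult big_ord_recl subn0.
rewrite big1 => [|k _]; rewrite coeft_const /= ?mul0r //.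
by rewrite addr0 mul1r expr1.
Qed.

Fact mult1r : right_id (tconst 1) mult.
Proof.
move=> p; apply: tpolyP => i; rewrite coeft_mult_rev big_ord_recl subn0.
rewrite big1 => [|k _]; rewrite coeft_const /= ?frob0 ?mulr0 //.
by rewrite addr0 expr1n mulr1.
Qed.

Fact multDl : left_distributive mult +%R.
Proof.
move=> p r s; apply: tpolyP => i; rewrite coeftD !coeft_mult -big_split.
by apply: eq_bigr => k _; rewrite coeftD mulrDl.
Qed.

Fact multDr : right_distributive mult +%R.
Proof.
move=> p r s; apply: tpolyP => i; rewrite coeftD !coeft_mult -big_split.
by apply: eq_bigr => k _; rewrite coeftD frobD mulrDr.
Qed.

Fact tconst1_neq0 : tconst 1 != 0.
Proof. exact: (oner_neq0 {poly R}). Qed.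

HB.instance Definition _ := GRing.Zmodule_isNzRing.Build R{tau}
  multA mult1l mult1r multDl multDr tconst1_neq0.

Lemma coeftM (p r : R{tau}) (i : nat) :
  coeft (p * r) i = \sum_(k < i.+1) coeft p k * coeft r (i - k) ^+ (q ^ k).
Proof. exact: coeft_mult. Qed.

Lemma coeft_constM (c : R) (p : R{tau}) (i : nat) :
  coeft (tconst c * p) i = c * coeft p i.
Proof.
rewrite coeftM big_ord_recl big1 => [|k _]; last first.
  by rewrite coeft_const /= mul0r.
by rewrite coeft_const /= subn0 expr1 addr0.
Qed.

Lemma coeft_Mconst (c : R) (p : R{tau}) (i : nat) :
  coeft (p * tconst c) i = coeft p i * c ^+ (q ^ i).
Proof.
rewrite coeftM big_ord_recr big1 /= => [|k _]; last first.
  by rewrite coeft_const subn_eq0 leqNgt ltn_ord /= frob0 mulr0.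
by rewrite subnn coeft_const add0r.
Qed.

Lemma tau_tconst (c : R) : tau * tconst c = tconst (c ^+ q) * tau.
Proof.
apply: tpolyP => i; rewrite coeft_constM coeft_Mconst /coeft /tau coefX.
by case: eqP => [->|_]; rewrite ?mul0r ?mulr0 // mul1r mulr1 expn1.
Qed.

(* The action of R{tau} on R, tau acting as the q-power map. *)
Definition evalt (p : R{tau}) (x : R) : R :=
  \sum_(i < sizet p) coeft p i * x ^+ (q ^ i).

Definition actmx (a b : nat) (M : 'M[R{tau}]_(a, b)) (v : 'cV[R]_b) :
    'cV[R]_a :=
  \col_i \sum_k evalt (M i k) (v k 0).

Definition coefmx (a b : nat) (M : 'M[R{tau}]_(a, b)) (i : nat) :
    'M[R]_(a, b) :=
  map_mx (fun p => coeft p i) M.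

Definition tdeg (a b : nat) (M : 'M[R{tau}]_(a, b)) : nat :=
  \max_i \max_k (sizet (M i k)).-1.

(* The twisted analogue of horner_morph. *)
Section HornerMatrix.
Variables (m : nat) (M : 'M[R{tau}]_m).

Definition hornert (p : {poly Fq}) : 'M[R{tau}]_m :=
  \sum_(i < size p) (tconst (j p`_i))%:M * M ^+ i.

Lemma tconst_j_comm (a : Fq) (p : R{tau}) :
  tconst (j a) * p = p * tconst (j a).
Proof.
by apply: tpolyP => i; rewrite coeft_constM coeft_Mconst frob_j mulrC.
Qed.

Lemma scalar_j_comm (a : Fq) (N : 'M[R{tau}]_m) :
  (tconst (j a))%:M * N = N * (tconst (j a))%:M.
Proof.
rewrite -![_ * _]/(_ *m _) mul_scalar_mx; apply/matrixP => i k; rewrite !mxE (bigD1 k) //= big1.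
  by rewrite !mxE eqxx mulr1n addr0 tconst_j_comm.
by move=> l /negPf lk; rewrite !mxE lk mulr0n mulr0.
Qed.

Let sc (a : Fq) : 'M[R{tau}]_m := (tconst (j a))%:M.

Let sc_nmod (a b : Fq) : sc (a + b) = sc a + sc b.
Proof. by rewrite /sc -raddfD /=; congr _%:M; rewrite /tconst rmorphD polyCD. Qed.

Let sc0 : sc 0 = 0.
Proof. by rewrite /sc /tconst rmorph0 polyC0 raddf0. Qed.

Let scM (a b : Fq) : sc (a * b) = sc a * sc b.
Proof.
rewrite /sc -[RHS]/(_ *m _) -scalar_mxM; congr _%:M; apply: tpolyP => i.
rewrite coeft_constM !coeft_const rmorphM /=.
by case: eqP => // _; rewrite mulr0.
Qed.

Let hornert_widen (n : nat) (p : {poly Fq}) : (size p <= n)%N ->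
  hornert p = \sum_(i < n) sc p`_i * M ^+ i.
Proof.
move=> le_pn; rewrite /hornert (big_ord_widen _ (fun i => sc p`_i * M ^+ i) le_pn).
rewrite big_mkcond; apply: eq_bigr => i _; case: ltnP => // le_pi.
by rewrite nth_default // sc0 mul0r.
Qed.

Lemma hornertD (p r : {poly Fq}) : hornert (p + r) = hornert p + hornert r.
Proof.
pose n := maxn (size p) (size r).
rewrite (@hornert_widen n p) ?leq_maxl // (@hornert_widen n r) ?leq_maxr //.
rewrite (@hornert_widen n (p + r)) ?size_polyD // -big_split.
by apply: eq_bigr => i _; rewrite coefD sc_nmod mulrDl.
Qed.

Lemma hornertC (a : Fq) : hornert a%:P = (tconst (j a))%:M.
Proof.
rewrite (@hornert_widen 1) ?size_polyC ?leq_b1 // big_ord1 coefC /=.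
by rewrite expr0 mulr1.
Qed.

Lemma hornertMX (p : {poly Fq}) : hornert (p * 'X) = hornert p * M.
Proof.
rewrite (@hornert_widen (size p).+1); last first.
  by rewrite (leq_trans (size_polyMleq _ _)) // size_polyX addn2.
rewrite big_ord_recl coefMX /= sc0 mul0r add0r /hornert mulr_suml.
by apply: eq_bigr => i _; rewrite coefMX /= exprSr mulrA.
Qed.

Lemma hornertX : hornert 'X = M.
Proof.
by rewrite -['X]mul1r hornertMX hornertC rmorph1 /tconst polyC1 -[RHS]mul1r.
Qed.

Fact hornert_zmod : zmod_morphism hornert.
Proof.
have H0 : hornert 0 = 0 by rewrite /hornert size_poly0 big_ord0.
have HN p : hornert (- p) = - hornert p.
  by apply/eqP; rewrite -subr_eq0 opprK -hornertD addNr H0.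
by move=> p r; rewrite hornertD HN.
Qed.

Fact hornert_monoid : monoid_morphism hornert.
Proof.
split=> [|p r]; first by rewrite -polyC1 hornertC rmorph1 /tconst polyC1.
have HCM a s : hornert (a%:P * s) = sc a * hornert s.
  rewrite mul_polyC (@hornert_widen (size s)) ?size_scale_leq //.
  rewrite [hornert s]/hornert mulr_sumr; apply: eq_bigr => i _.
  by rewrite coefZ scM mulrA.
have HM s : hornert s * M = M * hornert s.
  rewrite /hornert mulr_suml mulr_sumr; apply: eq_bigr => i _.
  by rewrite -mulrA -exprSr exprS !mulrA scalar_j_comm.
elim/poly_ind: p => [|p c IHp].
  by rewrite mul0r -[0]/(0%:P) hornertC /= -/(sc 0) sc0 mul0r.
rewrite mulrDl hornertD HCM mulrAC hornertMX IHp.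
by rewrite hornertD hornertMX hornertC mulrDl -!mulrA HM.
Qed.

HB.instance Definition _ :=
  GRing.isZmodMorphism.Build {poly Fq} 'M[R{tau}]_m hornert hornert_zmod.
HB.instance Definition _ :=
  GRing.isMonoidMorphism.Build {poly Fq} 'M[R{tau}]_m hornert hornert_monoid.

End HornerMatrix.

End TwistedPolynomials.

Section TModules.

Variables (Fq : finFieldType) (L : fieldType).
Variable iota : {rmorphism {poly Fq} -> L}.

Definition scal : {rmorphism Fq -> L} := iota \o polyC.

Local Notation "L{tau}" := (tpoly scal).
Local Notation theta := (iota 'X).

Definition nilpotent_mx (m : nat) (N : 'M[L]_m) : Prop :=
  exists k : nat, N ^+ k = 0.

Record tmodule (m : nat) : Type := TModule {
  tmod :> {rmorphism {poly Fq} -> 'M[L{tau}]_m};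
  tmod_Fq : forall a : Fq, tmod a%:P = (tconst scal (scal a))%:M;
  tmod_const : exists2 N : 'M[L]_m,
    nilpotent_mx N & coefmx (tmod 'X) 0 = theta%:M + N
}.

Definition no_nilpotence (m : nat) (Phi : tmodule m) : Prop :=
  coefmx (Phi 'X) 0 = theta%:M.

Definition tau_degree (m : nat) (Phi : tmodule m) : nat := tdeg (Phi 'X).

Definition strictly_pure (m : nat) (Phi : tmodule m) : Prop :=
  coefmx (Phi 'X) (tau_degree Phi) \in unitmx.

Section OfMatrix.
Variables (m : nat) (M : 'M[L{tau}]_m).
Hypothesis M0 : coefmx M 0 = theta%:M.

Fact tmod_of_Fq (a : Fq) : hornert M a%:P = (tconst scal (scal a))%:M.
Proof. exact: hornertC. Qed.

Fact tmod_of_const : exists2 N : 'M[L]_m,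
  nilpotent_mx N & coefmx (hornert M 'X) 0 = theta%:M + N.
Proof.
by exists 0; [exists 1%N; rewrite expr1 | rewrite hornertX addr0].
Qed.

(* The t-module with Phi_t = M, when M has constant term theta. *)
Definition tmod_of : tmodule m :=
  @TModule m (hornert M) tmod_of_Fq tmod_of_const.

End OfMatrix.

Fact Ga_const (k : nat) :
  coefmx ((tconst scal theta)%:M : 'M[L{tau}]_k) 0 = theta%:M.
Proof.
apply/matrixP => i l; rewrite !mxE; case: eqP => _.
  by rewrite !mulr1n coeft_const.
by rewrite !mulr0n /coeft coef0.
Qed.

Definition Ga (k : nat) : tmodule k := tmod_of (Ga_const k).

Fact carlitz_const :
  coefmx ((tconst scal theta + tau scal)%:M : 'M[L{tau}]_1) 0 = theta%:M.
Proof.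
apply/matrixP => i l; rewrite !ord1 !mxE eqxx !mulr1n coeftD coeft_const /=.
by rewrite /coeft /tau coefX addr0.
Qed.

Definition carlitz : tmodule 1 := tmod_of carlitz_const.

Definition tmod_morphism (m e : nat) (Phi : tmodule m) (Psi : tmodule e)
    (f : 'M[L{tau}]_(e, m)) : Prop :=
  f *m Phi 'X = Psi 'X *m f.

Definition tmod_iso (m e : nat) (Phi : tmodule m) (Psi : tmodule e) : Prop :=
  exists (f : 'M[L{tau}]_(e, m)) (g : 'M[L{tau}]_(m, e)),
    [/\ tmod_morphism Phi Psi f, tmod_morphism Psi Phi g,
        f *m g = 1%:M & g *m f = 1%:M].

(* Commutative L-algebras are ring morphisms h : L -> R; everything below is
   functorial in h, the points over L itself being those for h = idfun. *)
Section BaseChange.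
Variables (R : comNzRingType) (h : {rmorphism L -> R}).

Definition scalR : {rmorphism Fq -> R} := h \o scal.

Definition bc (a b : nat) (M : 'M[L{tau}]_(a, b)) : 'M[tpoly scalR]_(a, b) :=
  map_mx (map_poly h) M.

(* Biderivations over R from Phi to the Carlitz module are given by their value
   at t, a row vector over R{tau}; they are compared modulo inner ones. *)
Definition inner (m : nat) (Phi : tmodule m) (delta : 'rV[tpoly scalR]_m) :
    Prop :=
  exists U : 'rV[tpoly scalR]_m,
    delta = U *m bc (Phi 'X) - bc (carlitz 'X) *m U.

Definition combination (k m : nat) (b : 'M[L{tau}]_(k, m)) (c : 'cV[R]_k) :
    'rV[tpoly scalR]_m :=
  map_mx (tconst scalR) c^T *m bc b.

End BaseChange.

Definition biderivations (m : nat) : Type :=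
  forall (R : comNzRingType) (h : {rmorphism L -> R}),
    'rV[tpoly (scalR h)]_m -> Prop.

Definition Der (m : nat) : biderivations m := fun R h delta => True.

Definition Der0 (m : nat) : biderivations m :=
  fun R h delta => coefmx delta 0 = 0.

(* E is a t-module structure on D / (D :&: inner): for some "coordinates", i.e.
   rows b_1, ..., b_k in D, every class has a unique representative
   c_1 b_1 + ... + c_k b_k, and the action of t, namely delta |-> C_t delta, is
   c |-> E_t(c) in these coordinates. The coefficients are taken in all
   commutative L-algebras: for finite L, conditions on the points over L alone
   would not determine the twisted polynomials in E_t. *)
Definition tmod_structure (m k : nat) (Phi : tmodule m) (D : biderivations m)
    (E : tmodule k) : Prop :=
  exists b : 'M[L{tau}]_(k, m),
  forall (R : comNzRingType) (h : {rmorphism L -> R}),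
  [/\ forall c : 'cV[R]_k, D R h (combination h b c),
      forall delta : 'rV[tpoly (scalR h)]_m, D R h delta ->
        exists! c : 'cV[R]_k, inner Phi (delta - combination h b c)
    & forall c : 'cV[R]_k,
        inner Phi (bc h (carlitz 'X) *m combination h b c
                   - combination h b (actmx (bc h (E 'X)) c))].

Definition is_Ext1 (m k : nat) (Phi : tmodule m) (E : tmodule k) : Prop :=
  tmod_structure Phi (@Der m) E.

Definition is_dual (m k : nat) (Phi : tmodule m) (Phiv : tmodule k) : Prop :=
  tmod_structure Phi (@Der0 m) Phiv.

(* Exactness as algebraic groups: on the points over every commutative
   L-algebra. Surjectivity of g on points costs nothing, since the kernel is a
   power of the additive group and has no torsors over an affine base. *)
Definition short_exact (m1 m2 m3 : nat)
    (Phi1 : tmodule m1) (Phi2 : tmodule m2) (Phi3 : tmodule m3)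
    (f : 'M[L{tau}]_(m2, m1)) (g : 'M[L{tau}]_(m3, m2)) : Prop :=
  [/\ tmod_morphism Phi1 Phi2 f,
      tmod_morphism Phi2 Phi3 g
    & forall (R : comNzRingType) (h : {rmorphism L -> R}),
      [/\ injective (actmx (bc h f)),
          forall v : 'cV[R]_m2,
            actmx (bc h g) v = 0 <-> exists u, v = actmx (bc h f) u
        & forall w : 'cV[R]_m3, exists v, actmx (bc h g) v = w]].

End TModules.

(* Main.v *)
(* Write Phi_t = theta + M_1 tau + ... + M_n tau^n. Since n > 1 and M_n is
   invertible, U |-> U Phi_t - C_t U is triangular for the tau-degree, so every
   biderivation with zero constant term is equivalent to a unique
   c_1 tau + ... + c_{n-1} tau^{n-1}; reducing C_t times this expression gives
   the dual Psi explicitly.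

   For Psi, with U = (U_0, ..., U_{n-2}), triviality of a class means that U_0
   determines U_1, ..., U_{n-1} by U_{j+1} tau = rho_j + tau U_j - [U_j, theta]
   and that U_0 tau = sum_j U_j M_{j+1}^T. The defect of the last equation is
   again triangular in U_0, with leading coefficient 1, so only a constant row w
   survives: this is the coordinate on the bidual, and t acts on it by Phi_t.

   Coordinates are unique up to isomorphism: over L[x], the coordinates of the
   class of x b_j are polynomials in x, and any additive L-linear map commuting
   with the q-power map preserves inner biderivations; applying
   p |-> sum_i p_{q^i} r^{q^i} for all r, only the F_q-linear part of these
   polynomials matters, which gives a matrix over L{tau}.

   In the exact sequence, f expresses the classes with zero constant term in
   the coordinates of Ext^1, and g is the constant term of a biderivation, which
   is well defined because inner biderivations have zero constant term. *)

From HB Require Import structures.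
Require Import Defs.
From mathcomp Require Import all_boot all_order all_algebra all_field zify.

Set Implicit Arguments.
Unset Strict Implicit.
Unset Printing Implicit Defensive.

Import GRing.Theory.
Local Open Scope ring_scope.

(** * Matrices over R{tau}: coefficients, products and the action on columns *)

Section TwistedMatrices.

Variables (Fq : finFieldType) (R : comNzRingType) (j : {rmorphism Fq -> R}).
Local Notation q := #|Fq|.
Local Notation "R{tau}" := (tpoly j).

(** The F_q-algebra structure is an argument because additivity of [x ^+ (q ^ k)] depends on it;
    this lets [frob j k] be declared a ring morphism. *)
Definition frob of {rmorphism Fq -> R} := fun (k : nat) (x : R) => x ^+ (q ^ k).

Fact frob_zmod k : zmod_morphism (frob j k).
Proof.
by move=> x y; apply/eqP; rewrite /frob eq_sym subr_eq -(frobD j) subrK.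
Qed.

Fact frob_monoid k : monoid_morphism (frob j k).
Proof. by split=> [|x y]; rewrite /frob ?expr1n ?exprMn. Qed.

HB.instance Definition _ k :=
  GRing.isZmodMorphism.Build R R (frob j k) (frob_zmod k).
HB.instance Definition _ k :=
  GRing.isMonoidMorphism.Build R R (frob j k) (frob_monoid k).

Lemma frob_0 x : frob j 0 x = x.
Proof. by []. Qed.

Lemma frob_frob k l x : frob j k (frob j l x) = frob j (k + l) x.
Proof. by rewrite /frob -exprM -expnD addnC. Qed.

Lemma map_frob_0 m n (A : 'M[R]_(m, n)) : map_mx (frob j 0) A = A.
Proof. by apply/matrixP=> i k; rewrite mxE frob_0. Qed.

Lemma map_frob_frob k l m n (A : 'M[R]_(m, n)) :
  map_mx (frob j k) (map_mx (frob j l) A) = map_mx (frob j (k + l)) A.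
Proof. by apply/matrixP=> a b; rewrite !mxE frob_frob. Qed.

Lemma coefmxP m n (A B : 'M[R{tau}]_(m, n)) :
  (forall i, coefmx A i = coefmx B i) -> A = B.
Proof.
move=> eqAB; apply/matrixP=> a b; apply: tpolyP => i.
by have /matrixP/(_ a b) := eqAB i; rewrite !mxE.
Qed.

Lemma coefmx_zmod m n i :
  zmod_morphism (fun A : 'M[R{tau}]_(m, n) => coefmx A i).
Proof. by move=> A B; apply/matrixP=> a b; rewrite !mxE /coeft coefB. Qed.

Lemma coefmxB m n (A B : 'M[R{tau}]_(m, n)) i :
  coefmx (A - B) i = coefmx A i - coefmx B i.
Proof. exact: coefmx_zmod. Qed.

Lemma coefmxD m n (A B : 'M[R{tau}]_(m, n)) i :
  coefmx (A + B) i = coefmx A i + coefmx B i.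
Proof. by apply/matrixP=> a b; rewrite !mxE coeftD. Qed.

Lemma coeft_sum (I : finType) (F : I -> R{tau}) i :
  coeft (\sum_k F k) i = \sum_k coeft (F k) i.
Proof.
apply: (big_morph (fun p : R{tau} => coeft p i)) => [p r|].
  exact: coeftD.
by rewrite /coeft coef0.
Qed.

Lemma coefmxM m n p (A : 'M[R{tau}]_(m, n)) (B : 'M[R{tau}]_(n, p)) i :
  coefmx (A *m B) i =
  \sum_(k < i.+1) coefmx A k *m map_mx (frob j k) (coefmx B (i - k)).
Proof.
apply/matrixP=> a b; rewrite !mxE coeft_sum summxE.
under [RHS]eq_bigr => k _ do rewrite mxE.
rewrite exchange_big /=; apply: eq_bigr => l _; rewrite coeftM.
by apply: eq_bigr => k _; rewrite !mxE.
Qed.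

Lemma coefmx_finite m n (A : 'M[R{tau}]_(m, n)) :
  exists N, forall i, (N <= i)%N -> coefmx A i = 0.
Proof.
exists (\max_a \max_b sizet (A a b)) => i /bigmax_leqP leNi.
apply/matrixP=> a b; rewrite !mxE; apply: nth_default.
by have /bigmax_leqP/(_ b isT) := leNi a isT.
Qed.

Lemma tdeg_high m n (A : 'M[R{tau}]_(m, n)) i : (tdeg A < i)%N -> coefmx A i = 0.
Proof.
move=> lt_i; apply/matrixP=> a b; rewrite !mxE; apply: nth_default.
rewrite -/(sizet (A a b)) (leq_trans (leqSpred _)) // (leq_trans _ lt_i) // ltnS.
apply: leq_trans (leq_bigmax a).
exact: (leq_bigmax (F := fun b => (sizet (A a b)).-1)).
Qed.

Definition mxofcoef m n (f : nat -> 'M[R]_(m, n)) N : 'M[R{tau}]_(m, n) :=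
  \matrix_(a, b) (\poly_(i < N) f i a b : {poly R}).

Lemma coefmx_mxofcoef m n (f : nat -> 'M[R]_(m, n)) N i :
  coefmx (mxofcoef f N) i = if (i < N)%N then f i else 0.
Proof.
by apply/matrixP=> a b; rewrite !mxE /coeft coef_poly; case: ifP; rewrite ?mxE.
Qed.

Lemma coefmx_map_const m n (A : 'M[R]_(m, n)) i :
  coefmx (map_mx (tconst j) A) i = if i == 0%N then A else 0.
Proof. by apply/matrixP=> a b; rewrite !mxE coeft_const; case: eqP; rewrite ?mxE. Qed.

Lemma coefmx_constM m n p (A : 'M[R]_(m, n)) (B : 'M[R{tau}]_(n, p)) i :
  coefmx (map_mx (tconst j) A *m B) i = A *m coefmx B i.
Proof.
rewrite coefmxM big_ord_recl big1 => [|k _]; last by rewrite coefmx_map_const mul0mx.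
by rewrite coefmx_map_const subn0 map_frob_0 addr0.
Qed.

Lemma evalt_wide (p : R{tau}) x N : (sizet p <= N)%N ->
  evalt p x = \sum_(i < N) coeft p i * x ^+ (q ^ i).
Proof.
move=> lepN; rewrite /evalt (big_ord_widen _ (fun i => coeft p i * x ^+ (q ^ i)) lepN).
rewrite big_mkcond; apply: eq_bigr => i _; case: ltnP => // lepi.
by rewrite /coeft nth_default ?mul0r.
Qed.

(** One range of summation common to all entries turns the action into a sum of matrix products. *)
Lemma actmx_wide m n (A : 'M[R{tau}]_(m, n)) (v : 'cV[R]_n) N :
    (forall i, (N <= i)%N -> coefmx A i = 0) ->
  actmx A v = \sum_(i < N) coefmx A i *m map_mx (frob j i) v.
Proof.
move=> A0; apply/matrixP=> a b; rewrite ord1 !mxE summxE.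
under [RHS]eq_bigr => k _ do rewrite mxE.
rewrite exchange_big; apply: eq_bigr => l _; rewrite (@evalt_wide _ _ N).
  by apply: eq_bigr => i _; rewrite !mxE.
by apply/leq_sizeP=> i /A0/matrixP/(_ a l); rewrite !mxE.
Qed.

Lemma actmxDl m n (A B : 'M[R{tau}]_(m, n)) v :
  actmx (A + B) v = actmx A v + actmx B v.
Proof.
have [N A0] := coefmx_finite A; have [N' B0] := coefmx_finite B.
have A1 i : (maxn N N' <= i)%N -> coefmx A i = 0.
  by rewrite geq_max => /andP[/A0].
have B1 i : (maxn N N' <= i)%N -> coefmx B i = 0.
  by rewrite geq_max => /andP[_ /B0].
rewrite (actmx_wide _ A1) (actmx_wide _ B1) (@actmx_wide _ _ _ _ (maxn N N')).
  by rewrite -big_split; apply: eq_bigr => i _; rewrite coefmxD mulmxDl.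
by move=> i lei; rewrite coefmxD A1 // B1 // addr0.
Qed.

Lemma actmx_const m n (A : 'M[R]_(m, n)) v :
  actmx (map_mx (tconst j) A) v = A *m v.
Proof.
rewrite (@actmx_wide _ _ _ _ 1) ?big_ord1 ?coefmx_map_const ?map_frob_0 //.
by case=> // i _; rewrite coefmx_map_const.
Qed.

Lemma coefmx_scalar_tau n i :
  coefmx ((tau j)%:M : 'M[R{tau}]_n) i = if i == 1%N then 1%:M else 0.
Proof.
apply/matrixP=> a b; rewrite !mxE; case: ifP => i1; rewrite !mxE; case: (a == b).
- by rewrite !mulr1n /coeft /tau coefX i1.
- by rewrite !mulr0n /coeft coef0.
- by rewrite mulr1n /coeft /tau coefX i1.
by rewrite mulr0n /coeft coef0.
Qed.

Lemma actmx_tau n (v : 'cV[R]_n) : actmx ((tau j)%:M) v = map_mx (frob j 1) v.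
Proof.
rewrite (@actmx_wide _ _ _ _ 2).
  by rewrite big_ord_recl big_ord1 !coefmx_scalar_tau mul0mx mul1mx add0r.
by case=> [|[|i]] // _; rewrite coefmx_scalar_tau.
Qed.

Lemma evaltD (p r : R{tau}) x : evalt (p + r) x = evalt p x + evalt r x.
Proof.
have sz1 : (sizet p <= maxn (sizet p) (sizet r))%N by rewrite leq_maxl.
have sz2 : (sizet r <= maxn (sizet p) (sizet r))%N by rewrite leq_maxr.
have sz3 : (sizet (p + r)%R <= maxn (sizet p) (sizet r))%N by exact: size_polyD.
rewrite (evalt_wide _ sz1) (evalt_wide _ sz2) (evalt_wide _ sz3) -big_split.
by apply: eq_bigr => i _; rewrite coeftD mulrDl.
Qed.

Lemma evaltDr (p : R{tau}) x y : evalt p (x + y) = evalt p x + evalt p y.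
Proof.
rewrite /evalt -big_split.
by apply: eq_bigr => i _; rewrite (frobD j) mulrDr.
Qed.

Lemma evalt_constM c (p : R{tau}) x : evalt (tconst j c * p) x = c * evalt p x.
Proof.
rewrite (@evalt_wide _ _ (sizet p)).
  by rewrite mulr_sumr; apply: eq_bigr => i _; rewrite coeft_constM mulrA.
apply/leq_sizeP=> i lei.
by rewrite -[LHS]/(coeft (tconst j c * p) i) coeft_constM /coeft nth_default ?mulr0.
Qed.

Lemma coeft_tauM (p : R{tau}) i :
  coeft (tau j * p) i = if i is i'.+1 then coeft p i' ^+ q else 0.
Proof.
rewrite coeftM; case: i => [|i].
  by rewrite big_ord1 /coeft /tau coefX mul0r.
rewrite 2!big_ord_recl big1 => [|k _]; last by rewrite /tau /coeft coefX mul0r.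
by rewrite /coeft /tau !coefX mul0r mul1r add0r addr0 /= subSS subn0 expn1.
Qed.

Lemma evalt_tauM (p : R{tau}) x : evalt (tau j * p) x = evalt p x ^+ q.
Proof.
rewrite (@evalt_wide _ _ (sizet p).+1).
  rewrite big_ord_recl coeft_tauM mul0r add0r -[q in RHS]expn1.
  rewrite /evalt (frob_sum j); apply: eq_bigr => i _.
  by rewrite coeft_tauM exprMn -exprM -expnD addn1 expn1.
apply/leq_sizeP=> i lei; rewrite -[LHS]/(coeft (tau j * p) i) coeft_tauM.
case: i lei => // i lei; rewrite /coeft nth_default //.
by rewrite expr0n gtn_eqF // (ltn_trans _ (finNzRing_gt1 Fq)).
Qed.

(** Induction on ordinary polynomials carries over: the twisted product [p * tau j] is the ordinary
    product by 'X, because the coefficients of [tau] are 0 and 1, which q-powers fix. *)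
Lemma tpoly_ind (P : R{tau} -> Prop) : P 0 ->
  (forall p c, P p -> P (p * tau j + tconst j c)) -> forall p, P p.
Proof.
move=> P0 PS; apply: poly_ind => // p c Pp; have := PS p c Pp.
congr (P (_ + _)); apply: tpolyP => i; rewrite coeftM /coeft /tau.
rewrite coefMX; case: i => [|i]; first by rewrite big_ord1 coefX (frob0 Fq) mulr0.
rewrite big_ord_recr /= subnn coefX (frob0 Fq) mulr0 addr0.
rewrite big_ord_recr /= subSnn coefX expr1n mulr1 big1 ?add0r // => k _.
by rewrite coefX subSn 1?ltnW //= eqSS subn_eq0 leqNgt ltn_ord (frob0 Fq) mulr0.
Qed.

(** By induction on the left factor, it suffices to treat left multiplication by constants and by
    [tau]. *)
Lemma evaltM (p r : R{tau}) x : evalt (p * r) x = evalt p (evalt r x).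
Proof.
have E0 y : evalt (0 : R{tau}) y = 0 by rewrite /evalt /sizet size_poly0 big_ord0.
elim/tpoly_ind: p r x => [|p c IHp] r x; first by rewrite mul0r !E0.
rewrite mulrDl !evaltD evalt_constM -mulrA IHp evalt_tauM; congr (_ + _).
  rewrite -[tau j]mulr1 IHp evalt_tauM; congr (evalt p (_ ^+ _)).
  by rewrite -[1]/(tconst j 1) -[tconst j 1]mulr1 evalt_constM mul1r
             /evalt /sizet size_poly1 big_ord1 /coeft coef1 mul1r.
by rewrite -[tconst j c]mulr1 evalt_constM /evalt /sizet size_poly1 big_ord1
           /coeft coef1 mul1r.
Qed.

Lemma actmxM m n p (A : 'M[R{tau}]_(m, n)) (B : 'M[R{tau}]_(n, p)) v :
  actmx (A *m B) v = actmx A (actmx B v).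
Proof.
apply/matrixP=> a b; rewrite ord1 !mxE.
have E0 y : evalt (0 : R{tau}) y = 0 by rewrite /evalt /sizet size_poly0 big_ord0.
have E0r (r : R{tau}) : evalt r 0 = 0.
  by apply: (addrI (evalt r 0)); rewrite -evaltDr !addr0.
transitivity (\sum_k \sum_l evalt (A a l * B l k) (v k 0)).
  apply: eq_bigr => k _; rewrite !mxE.
  by apply: (big_morph (fun r : R{tau} => evalt r (v k 0))) => [r s|]; rewrite ?evaltD.
rewrite exchange_big; apply: eq_bigr => l _; rewrite !mxE.
rewrite (big_morph (evalt (A a l)) (evaltDr _) (E0r _)).
by apply: eq_bigr => k _; rewrite evaltM.
Qed.

Lemma coefmx_scalar_const n c i :
  coefmx ((tconst j c)%:M : 'M[R{tau}]_n) i = if i == 0%N then c%:M else 0.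
Proof.
apply/matrixP=> a b; rewrite !mxE; case: ifP => i0; rewrite !mxE; case: (a == b).
- by rewrite !mulr1n coeft_const i0.
- by rewrite !mulr0n /coeft coef0.
- by rewrite mulr1n coeft_const i0.
by rewrite mulr0n /coeft coef0.
Qed.

Lemma scalar_tconst n c : (tconst j c)%:M = map_mx (tconst j) c%:M :> 'M[R{tau}]_n.
Proof. by apply: coefmxP => i; rewrite coefmx_scalar_const coefmx_map_const. Qed.

Lemma actmx_scalar n c (v : 'cV[R]_n) : actmx (tconst j c)%:M v = c *: v.
Proof. by rewrite scalar_tconst actmx_const mul_scalar_mx. Qed.

Lemma actmx1 n (v : 'cV[R]_n) : actmx (1%:M : 'M[R{tau}]_n) v = v.
Proof. by rewrite -[LHS]/(actmx (tconst j 1)%:M v) actmx_scalar scale1r. Qed.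

Lemma coefmx_tauM m n (A : 'M[R{tau}]_(m, n)) i :
  coefmx ((tau j)%:M *m A) i =
  if i is i'.+1 then map_mx (frob j 1) (coefmx A i') else 0.
Proof.
apply/matrixP=> a b; rewrite mul_scalar_mx !mxE coeft_tauM.
by case: i => [|i]; rewrite !mxE // /frob expn1.
Qed.

End TwistedMatrices.

(** * Coordinates on biderivations modulo inner ones *)

Section Coordinates.

Variables (Fq : finFieldType) (L : fieldType) (iota : {rmorphism {poly Fq} -> L}).
Local Notation q := #|Fq|.
Local Notation L_scal := (scal iota).
Local Notation "L{tau}" := (tpoly L_scal).
Local Notation C_t := (carlitz iota 'X).
Local Notation theta := (iota 'X).

(** * Biderivations over a commutative L-algebra, and the inner ones *)

Section Points.

Variables (R : comNzRingType) (h : {rmorphism L -> R}).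
Local Notation sR := (scalR iota h).
Local Notation "R{tau}" := (tpoly sR).

Lemma coefmx_bc m n (A : 'M[L{tau}]_(m, n)) i :
  coefmx (bc h A) i = map_mx h (coefmx A i).
Proof. by apply/matrixP=> a b; rewrite !mxE /coeft coef_map. Qed.

Lemma map_frob_h k m n (A : 'M[L]_(m, n)) :
  map_mx (frob sR k) (map_mx h A) = map_mx h (map_mx (frob L_scal k) A).
Proof. by apply/matrixP=> a b; rewrite !mxE /frob rmorphXn. Qed.

Lemma bcM m n p (A : 'M[L{tau}]_(m, n)) (B : 'M[L{tau}]_(n, p)) :
  bc h (A *m B) = bc h A *m bc h B.
Proof.
apply: coefmxP => i; rewrite coefmx_bc !coefmxM map_mx_sum.
by apply: eq_bigr => k _; rewrite map_mxM !coefmx_bc map_frob_h.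
Qed.

Lemma bcD m n (A B : 'M[L{tau}]_(m, n)) : bc h (A + B) = bc h A + bc h B.
Proof. by apply: coefmxP => i; rewrite coefmx_bc !coefmxD map_mxD !coefmx_bc. Qed.

Lemma bc_const m n (A : 'M[L]_(m, n)) :
  bc h (map_mx (tconst L_scal) A) = map_mx (tconst sR) (map_mx h A).
Proof.
apply: coefmxP => i; rewrite coefmx_bc !coefmx_map_const.
by case: ifP; rewrite ?map_mx0.
Qed.

Lemma bc1 m : bc h (1%:M : 'M[L{tau}]_m) = 1%:M.
Proof.
have E (R' : comNzRingType) (j : {rmorphism Fq -> R'}) :
    (1%:M : 'M[tpoly j]_m) = map_mx (tconst j) 1%:M.
  apply/matrixP=> a b; rewrite !mxE; case: (a == b); rewrite ?mulr1n //.
by rewrite E bc_const map_mx1 -E.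
Qed.

Lemma bc_tau m : bc h ((tau L_scal)%:M : 'M[L{tau}]_m) = (tau sR)%:M.
Proof.
apply: coefmxP => i; rewrite coefmx_bc !coefmx_scalar_tau.
by case: ifP; rewrite ?map_mx1 ?map_mx0.
Qed.

Lemma coefmx_combination k m (b : 'M[L{tau}]_(k, m)) c i :
  coefmx (combination h b c) i = c^T *m map_mx h (coefmx b i).
Proof. by rewrite coefmx_constM coefmx_bc. Qed.

Lemma combinationD k m (b : 'M[L{tau}]_(k, m)) c c' :
  combination h b (c + c') = combination h b c + combination h b c'.
Proof.
apply: coefmxP => i; rewrite coefmxD !coefmx_combination.
by rewrite linearD mulmxDl.
Qed.

Lemma combinationB k m (b : 'M[L{tau}]_(k, m)) c c' :
  combination h b (c - c') = combination h b c - combination h b c'.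
Proof.
apply: coefmxP => i; rewrite coefmxB !coefmx_combination.
by rewrite linearB mulmxBl.
Qed.

Lemma combination_sum k m (b : 'M[L{tau}]_(k, m)) (I : finType) (F : I -> _) :
  combination h b (\sum_i F i) = \sum_i combination h b (F i).
Proof.
apply: (big_morph (combination h b)) => [c c'|]; first exact: combinationD.
by rewrite -(subrr 0) combinationB subrr.
Qed.

Lemma combination_mul k m p (b : 'M[L{tau}]_(k, m)) (f : 'M[L{tau}]_(m, p)) c :
  combination h (b *m f) c = combination h b c *m bc h f.
Proof. by rewrite /combination bcM mulmxA. Qed.

Section Inner.

Variables (m : nat) (Psi : tmodule iota m).
Implicit Types delta : 'rV[R{tau}]_m.

Lemma inner0 : inner Psi (0 : 'rV[R{tau}]_m).
Proof. by exists 0; rewrite mul0mx mulmx0 subrr. Qed.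

Lemma innerD delta1 delta2 :
  inner Psi delta1 -> inner Psi delta2 -> inner Psi (delta1 + delta2).
Proof.
move=> [U ->] [V ->]; exists (U + V).
by rewrite mulmxDl mulmxDr opprD addrACA.
Qed.

Lemma innerN delta : inner Psi delta -> inner Psi (- delta).
Proof. by move=> [U ->]; exists (- U); rewrite mulNmx mulmxN opprD. Qed.

Lemma inner_sum (I : finType) (F : I -> 'rV[R{tau}]_m) :
  (forall i, inner Psi (F i)) -> inner Psi (\sum_i F i).
Proof.
move=> innF; elim/big_ind: _ => // [|d1 d2]; first exact: inner0.
exact: innerD.
Qed.

Lemma inner_trans delta2 delta1 delta3 :
  inner Psi (delta1 - delta2) -> inner Psi (delta2 - delta3) ->
  inner Psi (delta1 - delta3).
Proof. by move=> i1 i2; rewrite -(subrK delta2 delta1) -addrA; apply: innerD. Qed.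

Lemma inner_sym delta1 delta2 :
  inner Psi (delta1 - delta2) -> inner Psi (delta2 - delta1).
Proof. by move=> /innerN; rewrite opprB. Qed.

(** Left multiplication by C_t commutes with U |-> U Psi_t - C_t U, so C_t U is a witness. *)
Lemma inner_carlitz delta : inner Psi delta -> inner Psi (bc h C_t *m delta).
Proof.
move=> [U ->]; exists (bc h C_t *m U).
by rewrite mulmxBr !mulmxA.
Qed.

Lemma inner_morphism p (Psi' : tmodule iota p) f delta :
  tmod_morphism Psi' Psi f -> inner Psi delta -> inner Psi' (delta *m bc h f).
Proof.
move=> morf [U ->]; exists (U *m bc h f).
by rewrite mulmxBl -!mulmxA -!bcM morf.
Qed.

End Inner.

Lemma carlitzE : C_t = (tconst L_scal theta)%:M + (tau L_scal)%:M.
Proof. by rewrite -raddfD; apply: hornertX. Qed.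

Lemma bc_carlitz : bc h C_t = (tconst sR (h theta))%:M + (tau sR)%:M.
Proof.
by rewrite carlitzE bcD bc_tau !scalar_tconst bc_const map_scalar_mx.
Qed.

Lemma coefmx_carlitzM m (delta : 'rV[R{tau}]_m) i :
  coefmx (bc h C_t *m delta) i = h theta *: coefmx delta i +
    (if i is i'.+1 then map_mx (frob sR 1) (coefmx delta i') else 0).
Proof.
rewrite bc_carlitz mulmxDl coefmxD coefmx_tauM scalar_tconst coefmx_constM.
by rewrite mul_scalar_mx.
Qed.

End Points.

(** * Semilinear changes of coefficients and F_q-linear parts of polynomials *)

Section Semilinear.

Variables (R R' : comNzRingType) (h : {rmorphism L -> R}) (h' : {rmorphism L -> R'}).
Variable phi : R -> R'.
Hypothesis phiB : zmod_morphism phi.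
Hypothesis phiZ : forall a x, phi (h a * x) = h' a * phi x.
Hypothesis phiX : forall x, phi (x ^+ q) = phi x ^+ q.

Let phi0 : phi 0 = 0.
Proof. by rewrite -(subrr 0) phiB subrr. Qed.

Let phiD x y : phi (x + y) = phi x + phi y.
Proof. by rewrite -{1}(opprK y) phiB -(sub0r y) phiB phi0 sub0r opprK. Qed.

Let phi_sum (I : finType) (F : I -> R) : phi (\sum_i F i) = \sum_i phi (F i).
Proof. exact: (big_morph phi phiD phi0). Qed.

Let phiXk k x : phi (x ^+ (q ^ k)) = phi x ^+ (q ^ k).
Proof. by elim: k => // k IHk; rewrite expnSr !exprM phiX IHk. Qed.

Definition mapt m n (A : 'M[tpoly (scalR iota h)]_(m, n)) :
  'M[tpoly (scalR iota h')]_(m, n) := map_mx (map_poly phi) A.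

Lemma coefmx_mapt m n (A : 'M[tpoly (scalR iota h)]_(m, n)) i :
  coefmx (mapt A) i = map_mx phi (coefmx A i).
Proof. by apply/matrixP=> a b; rewrite !mxE /coeft coef_map_id0. Qed.

(** Although [phi] is not assumed multiplicative, the coefficients of U Psi_t - C_t U arise from
    those of U by sums, multiplication by elements of L and q-powers, all of which [phi]
    respects. *)
Lemma mapt_inner m (Psi : tmodule iota m) (delta : 'rV[tpoly (scalR iota h)]_m) :
  inner Psi delta -> inner Psi (mapt delta).
Proof.
move=> [U ->]; exists (mapt U); apply: coefmxP => i.
rewrite coefmx_mapt !coefmxB !coefmxM.
rewrite [LHS](_ : _ = map_mx phi (\sum_(k < i.+1) coefmx U k *m
    map_mx (frob (scalR iota h) k) (coefmx (bc h (Psi 'X)) (i - k))) -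
  map_mx phi (\sum_(k < i.+1) coefmx (bc h C_t) k *m
    map_mx (frob (scalR iota h) k) (coefmx U (i - k)))); last first.
  by apply/matrixP=> a b; rewrite !mxE phiB.
congr (_ - _); apply/matrixP=> a b; rewrite !mxE !summxE phi_sum;
  apply: eq_bigr => k _; rewrite !mxE phi_sum; apply: eq_bigr => l _.
  rewrite coefmx_mapt !coefmx_bc !map_frob_h ![in LHS]mxE mulrC phiZ mulrC.
  by rewrite !mxE.
by rewrite coefmx_mapt !coefmx_bc !mxE phiZ /frob phiXk.
Qed.

Lemma mapt_combination k m (b : 'M[L{tau}]_(k, m)) c :
  mapt (combination h b c) = combination h' b (map_mx phi c).
Proof.
apply: coefmxP => i; rewrite coefmx_mapt !coefmx_combination.
apply/matrixP=> a e; rewrite !mxE phi_sum; apply: eq_bigr => l _.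
by rewrite !mxE mulrC phiZ mulrC.
Qed.

Lemma maptB m n (A B : 'M[tpoly (scalR iota h)]_(m, n)) :
  mapt (A - B) = mapt A - mapt B.
Proof.
apply: coefmxP => i; rewrite coefmxB !coefmx_mapt coefmxB.
by apply/matrixP=> a e; rewrite !mxE phiB.
Qed.

End Semilinear.

(** Only exponents that are powers of q are kept, x^(q^i) becoming tau^i. The range [size p]
    suffices since i < q^i. *)
Definition linear_part (p : {poly L}) : L{tau} :=
  (\poly_(i < size p) p`_(q ^ i) : {poly L}).

Lemma coeft_linear_part p i : coeft (linear_part p) i = p`_(q ^ i).
Proof.
rewrite /coeft coef_poly; case: ltnP => // le_pi.
by rewrite nth_default // (leq_trans le_pi) // ltnW // ltn_expl ?finNzRing_gt1.
Qed.

Lemma poly_frob (p : {poly L}) :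
  p ^+ q = \sum_(i < size p) (p`_i ^+ q)%:P * 'X^(i * q).
Proof.
(* An F_q-algebra structure on {poly L}, which makes [frob_sum] applicable there. *)
have j : {rmorphism Fq -> {poly L}} := polyC \o L_scal.
rewrite -{1}[p]coefK poly_def -[q in LHS]expn1 (frob_sum j).
by apply: eq_bigr => i _; rewrite expn1 exprZn -exprM mul_polyC.
Qed.

(** The exponents in p^q are the multiples k q. None of them is q^0 = 1, and k q = q^(i+1) exactly
    when k = q^i. *)
Lemma linear_partX p : linear_part (p ^+ q) = tau L_scal * linear_part p.
Proof.
have q_gt1 := finNzRing_gt1 Fq; have q_gt0 := ltnW q_gt1.
apply: tpolyP => i; rewrite coeft_tauM coeft_linear_part poly_frob coef_sum.
case: i => [|i].
  apply: big1 => i _; rewrite coefCM coefXn expn0; case: eqP => [E|_].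
    have := dvdn_mull i (dvdnn q); rewrite -E dvdn1 => /eqP q1.
    by rewrite q1 in q_gt1.
  by rewrite mulr0.
rewrite coeft_linear_part expnSr; under eq_bigr => k _.
  rewrite coefCM coefXn eqn_pmul2r //; over.
have [lt_ip|le_pi] := ltnP (q ^ i) (size p).
  rewrite (bigD1 (Ordinal lt_ip)) //= eqxx mulr1 big1 ?addr0 // => k.
  by rewrite -val_eqE eq_sym /= => /negPf->; rewrite mulr0.
rewrite nth_default // big1 ?expr0n ?gtn_eqF // => k _.
by rewrite gtn_eqF ?mulr0 // (leq_trans _ le_pi).
Qed.

Lemma linear_part_X : linear_part 'X = tconst L_scal 1.
Proof.
apply: tpolyP => i; rewrite coeft_linear_part coeft_const coefX.
have q_gt1 := finNzRing_gt1 Fq.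
case: i => // i; have lt1 : (1 < q ^ i.+1)%N by rewrite -(expn0 q) ltn_exp2l.
by rewrite gtn_eqF.
Qed.

Section Specialization.

Variables (R : comNzRingType) (h : {rmorphism L -> R}) (r : R).
Local Notation sR := (scalR iota h).

Lemma coeft_map (p : L{tau}) i : coeft (map_poly h p : tpoly sR) i = h (coeft p i).
Proof. exact: coef_map. Qed.

(** This is not substitution of r for x: monomials whose exponent is not a power of q are sent to 0,
    so that the result is a twisted polynomial applied to r. *)
Definition specialize (p : {poly L}) : R :=
  evalt (map_poly h (linear_part p) : tpoly sR) r.

Lemma specializeB : zmod_morphism specialize.
Proof.
have E : {morph (fun p : tpoly sR => evalt p r) : p s / p + s}.
  by move=> p s; apply: evaltD.
move=> p s; apply/eqP; rewrite eq_sym subr_eq -E /specialize; apply/eqP.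
congr evalt; apply: tpolyP => i.
by rewrite coeftD !coeft_map !coeft_linear_part coefB rmorphB subrK.
Qed.

Lemma specializeZ a p : specialize (a%:P * p) = h a * specialize p.
Proof.
rewrite /specialize -evalt_constM; congr evalt; apply: tpolyP => i.
by rewrite coeft_constM !coeft_map !coeft_linear_part coefCM rmorphM.
Qed.

Lemma specializeX p : specialize (p ^+ q) = specialize p ^+ q.
Proof.
rewrite /specialize -evalt_tauM; congr evalt; apply: tpolyP => i.
rewrite coeft_tauM linear_partX coeft_map coeft_tauM.
by case: i => [|i]; rewrite ?coeft_map ?rmorph0 ?rmorphXn.
Qed.

Lemma specialize_var : specialize 'X = r.
Proof.
rewrite /specialize linear_part_X.
have -> : (map_poly h (tconst L_scal 1) : tpoly sR) = tconst sR 1 * tconst sR 1.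
  apply: tpolyP => i; rewrite coeft_map coeft_constM !coeft_const mul1r.
  by case: ifP; rewrite ?rmorph1 ?rmorph0.
rewrite evalt_constM mul1r /evalt /sizet size_polyC oner_eq0 big_ord1.
by rewrite coeft_const mul1r.
Qed.

End Specialization.

(** * Coordinate systems and their uniqueness up to isomorphism *)

Definition coordinates m k (Psi : tmodule iota m) (D : biderivations iota m)
    (b : 'M[L{tau}]_(k, m)) : Prop :=
  forall (R : comNzRingType) (h : {rmorphism L -> R}),
    (forall c, D R h (combination h b c)) /\
    (forall delta, D R h delta ->
       exists! c, inner Psi (delta - combination h b c)).

(** The third clause of [tmod_structure], for a twisted matrix not yet known to come from a
    t-module; [coordinates] holds the other two clauses. *)
Definition t_action m k (Psi : tmodule iota m) (b : 'M[L{tau}]_(k, m))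
    (T : 'M[L{tau}]_k) : Prop :=
  forall (R : comNzRingType) (h : {rmorphism L -> R}) c,
    inner Psi (bc h C_t *m combination h b c - combination h b (actmx (bc h T) c)).

Lemma tmod_structureP m k (Psi : tmodule iota m) D (E : tmodule iota k) :
  tmod_structure Psi D E <->
  exists2 b, coordinates Psi D b & t_action Psi b (E 'X).
Proof.
split=> [[b H]|[b H1 H2]]; exists b; move=> R h; first by case: (H R h).
  by case: (H R h).
by case: (H1 R h); split.
Qed.

Lemma coordinates_inj m k (Psi : tmodule iota m) D (b : 'M[L{tau}]_(k, m))
    (R : comNzRingType) (h : {rmorphism L -> R}) c c' :
  coordinates Psi D b ->
  inner Psi (combination h b c - combination h b c') -> c = c'.
Proof.
move=> /(_ R h)[Db /(_ _ (Db c))[c0 [_ c0P]]] innc.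
by rewrite -(c0P c') // -(c0P c) // subrr; apply: inner0.
Qed.

(** Testing on the columns x e_b over L[x] recovers every coefficient, because the exponents q^i are
    pairwise distinct. *)
Lemma actmx_faithful m k (F G : 'M[L{tau}]_(m, k)) :
  (forall (R : comNzRingType) (h : {rmorphism L -> R}) c,
     actmx (bc h F) c = actmx (bc h G) c) -> F = G.
Proof.
move=> eqFG; apply/matrixP=> a b; apply: tpolyP => i.
have E (H : 'M[L{tau}]_(m, k)) :
    actmx (bc polyC H) ('X *: delta_mx b 0) a 0
      = \sum_(l < sizet (H a b)) (coeft (H a b) l)%:P * 'X^(q ^ l).
  rewrite mxE (bigD1 b) //= big1 => [|l nlb]; last first.
    rewrite !mxE (negPf nlb) mulr0 /evalt big1 // => e _.
    by rewrite (frob0 Fq) mulr0.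
  rewrite addr0 !mxE !eqxx mulr1 (@evalt_wide _ _ _ _ _ (sizet (H a b))).
    by apply: eq_bigr => l _; rewrite /coeft coef_map.
  exact: size_poly.
have E' (H : 'M[L{tau}]_(m, k)) :
    (actmx (bc polyC H) ('X *: delta_mx b 0) a 0)`_(q ^ i) = coeft (H a b) i.
  rewrite E coef_sum; under eq_bigr => l _.
    rewrite coefCM coefXn (inj_eq (expnI (finNzRing_gt1 Fq))); over.
  have [lt_i|le_i] := ltnP i (sizet (H a b)).
    rewrite (bigD1 (Ordinal lt_i)) //= eqxx mulr1 big1 ?addr0 // => l.
    by rewrite -val_eqE eq_sym /= => /negPf->; rewrite mulr0.
  rewrite /coeft nth_default // big1 // => l _.
  by rewrite gtn_eqF ?mulr0 // (leq_trans _ le_i).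
by rewrite -!E' eqFG.
Qed.

(** The generic columns x e_l over L[x] are treated first. Any column c is the sum over l of their
    specializations at x = c_l, and [specialize] carries inner biderivations to inner ones. *)
Lemma coordinates_lift m k k' (Psi : tmodule iota m) D
    (b : 'M[L{tau}]_(k, m)) (b' : 'M[L{tau}]_(k', m)) :
    coordinates Psi D b' ->
    (forall (R : comNzRingType) (h : {rmorphism L -> R}) c,
       D R h (combination h b c)) ->
  exists F : 'M[L{tau}]_(k', k),
    forall (R : comNzRingType) (h : {rmorphism L -> R}) c,
      inner Psi (combination h b c - combination h b' (actmx (bc h F) c)).
Proof.
move=> coord_b' Db; pose h0 : {rmorphism L -> {poly L}} := polyC.
pose x l : 'cV[{poly L}]_k := 'X *: delta_mx l 0.
have xP l : exists c,
    inner Psi (combination h0 b (x l) - combination h0 b' c).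
  have [_ /(_ _ (Db _ h0 (x l)))[c [Hc _]]] := coord_b' _ h0.
  by exists c.
have [c' c'P] := fin_all_exists xP.
(* Column l acts on c_l as specialization of the generic coordinates [c' l] at c_l. *)
exists (\matrix_(a, l) linear_part (c' l a 0)) => R h c.
pose phi l := specialize h (c l 0).
have phiB l := specializeB h (c l 0); have phiZ l := specializeZ h (c l 0).
have phi0 l : phi l 0 = 0 by have := phiB l 0 0; rewrite !subrr.
have cE : c = \sum_l map_mx (phi l) (x l).
  apply/matrixP=> a e; rewrite ord1 summxE (bigD1 a) //= big1 => [|l nla].
    by rewrite !mxE !eqxx mulr1 addr0 /phi specialize_var.
  by rewrite !mxE eq_sym (negPf nla) mulr0.
have -> : actmx (bc h (\matrix_(a, l) linear_part (c' l a 0))) c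
    = \sum_l map_mx (phi l) (c' l).
  apply/matrixP=> a e; rewrite ord1 summxE mxE.
  by apply: eq_bigr => l _; rewrite !mxE.
rewrite [X in combination h b X]cE.
rewrite !combination_sum -sumrB; apply: inner_sum => l.
have mapE := @mapt_combination _ _ h0 h _ (phiB l) (phiZ l).
rewrite -!mapE -(maptB h (phiB l)).
apply: (mapt_inner (phiB l) (phiZ l)) => //; exact: specializeX.
Qed.

(** Applied to c, both sides are coordinates in [b'] of C_t times the class of [combination h b c],
    so they agree by uniqueness of coordinates. *)
Lemma coordinates_morphism m k k' (Psi : tmodule iota m) D
    (b : 'M[L{tau}]_(k, m)) (b' : 'M[L{tau}]_(k', m)) T T' F :
    coordinates Psi D b' -> t_action Psi b T -> t_action Psi b' T' ->
    (forall (R : comNzRingType) (h : {rmorphism L -> R}) c,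
      inner Psi (combination h b c - combination h b' (actmx (bc h F) c))) ->
  F *m T = T' *m F.
Proof.
move=> coord_b' actT actT' FP; apply: actmx_faithful => R h c.
rewrite !bcM !actmxM; apply: (coordinates_inj (h := h) coord_b').
apply: inner_trans (inner_sym (FP _ _ _)) _.
apply: inner_trans (inner_sym (actT _ _ _)) _.
apply: inner_trans (actT' _ _ _).
by rewrite -mulmxBr; apply: inner_carlitz.
Qed.

Lemma tmod_structure_unique m k k' (Psi : tmodule iota m) D
    (E : tmodule iota k) (E' : tmodule iota k') :
  tmod_structure Psi D E -> tmod_structure Psi D E' -> tmod_iso E E'.
Proof.
move=> /tmod_structureP[b coord_b act_b] /tmod_structureP[b' coord_b' act_b'].
have [F FP] := coordinates_lift coord_b' (fun R h => (coord_b R h).1).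
have [G GP] := coordinates_lift coord_b (fun R h => (coord_b' R h).1).
have act1 p (R : comNzRingType) (h : {rmorphism L -> R}) (c : 'cV_p) :
    actmx (bc h (1%:M : 'M[L{tau}]_p)) c = c.
  by rewrite bc1 actmx1.
exists F, G; split.
- exact: coordinates_morphism FP.
- exact: coordinates_morphism GP.
- apply: actmx_faithful => R h c; rewrite act1 bcM actmxM.
  apply: (coordinates_inj (h := h) coord_b'); apply: inner_sym.
  exact: inner_trans (GP _ _ _) (FP _ _ _).
- apply: actmx_faithful => R h c; rewrite act1 bcM actmxM.
  apply: (coordinates_inj (h := h) coord_b); apply: inner_sym.
  exact: inner_trans (FP _ _ _) (GP _ _ _).
Qed.

(** Right multiplications by f and g are mutually inverse and preserve both inner biderivations and
    zero constant terms. Hence the rows of [b *m f] are coordinates with the same action of t. *)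
Lemma is_dual_iso m m' k (Psi : tmodule iota m) (Psi' : tmodule iota m')
    (E : tmodule iota k) :
  tmod_iso Psi' Psi -> is_dual Psi E -> is_dual Psi' E.
Proof.
move=> [f [g [morf morg fg gf]]] /tmod_structureP[b coord_b act_b].
have fgR (R : comNzRingType) (h : {rmorphism L -> R}) : bc h f *m bc h g = 1%:M.
  by rewrite -bcM fg bc1.
have gfR (R : comNzRingType) (h : {rmorphism L -> R}) : bc h g *m bc h f = 1%:M.
  by rewrite -bcM gf bc1.
have Der0M (R : comNzRingType) (h : {rmorphism L -> R}) a a' (d : 'rV_a)
    (e : 'M_(a, a')) :
    Der0 d -> Der0 (d *m bc h e : 'rV[tpoly (scalR iota h)]_a').
  by rewrite /Der0 coefmxM big_ord1 => ->; rewrite mul0mx.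
apply/tmod_structureP; exists (b *m f) => R h; last first.
  move=> c; rewrite !combination_mul mulmxA -mulmxBl.
  exact: inner_morphism morf (act_b _ _ _).
have [Db bP] := coord_b R h; split=> [c|delta Ddelta].
  by rewrite combination_mul; apply: Der0M.
have innE c : inner Psi' (delta - combination h (b *m f) c) <->
              inner Psi (delta *m bc h g - combination h b c).
  rewrite combination_mul; split=> [/(inner_morphism morg)|/(inner_morphism morf)].
    by rewrite mulmxBl -mulmxA fgR mulmx1.
  by rewrite mulmxBl -mulmxA gfR mulmx1.
have [c [/innE inn_c cP]] := bP _ (Der0M _ _ _ _ _ g Ddelta).
by exists c; split=> // c' /innE/cP.
Qed.

(** * Constant terms: from the dual to Ext^1 and the exact sequence *)

Section NoNilpotence.

Variables (m : nat) (Psi : tmodule iota m).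
Hypothesis nil : no_nilpotence Psi.

(** The constant term of U Psi_t - C_t U is U_0 theta - theta U_0 when Psi has no nilpotence. *)
Lemma inner_Der0 (R : comNzRingType) (h : {rmorphism L -> R}) delta :
  inner Psi delta -> Der0 (delta : 'rV[tpoly (scalR iota h)]_m).
Proof.
move=> [U ->]; rewrite /Der0 coefmxB coefmx_carlitzM coefmxM big_ord1 coefmx_bc nil.
by rewrite map_frob_0 map_scalar_mx mul_mx_scalar addr0 subrr.
Qed.

Definition with_constants k (b : 'M[L{tau}]_(k, m)) : 'M[L{tau}]_(k + m, m) :=
  col_mx b 1%:M.

Lemma coefmx_1 n i : coefmx (1%:M : 'M[L{tau}]_n) i = if i == 0%N then 1%:M else 0.
Proof. exact: coefmx_scalar_const. Qed.

Lemma combination_constants k (b : 'M[L{tau}]_(k, m))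
    (R : comNzRingType) (h : {rmorphism L -> R}) c :
  combination h (with_constants b) c =
  combination h b (usubmx c) + combination h 1%:M (dsubmx c).
Proof.
apply: coefmxP => i; rewrite coefmxD !coefmx_combination.
rewrite -[in LHS](vsubmxK c) tr_col_mx.
rewrite [coefmx (with_constants b) i]
    (_ : _ = col_mx (coefmx b i) (coefmx (1%:M : 'M[L{tau}]_m) i)).
  by rewrite map_col_mx mul_row_col.
by rewrite /with_constants /coefmx map_col_mx.
Qed.

(** The constant term depends only on the class, hence gives the last m coordinates; once it is
    subtracted, a class of [Der0] remains. *)
Lemma coordinates_constants k (b : 'M[L{tau}]_(k, m)) :
  coordinates Psi (@Der0 _ _ iota m) b ->
  coordinates Psi (@Der _ _ iota m) (with_constants b).
Proof.
move=> coord_b R h; split=> // delta _; have [Db bP] := coord_b R h.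
pose u := (coefmx delta 0)^T.
have coef1 (c : 'cV[R]_m) :
    coefmx (combination h (1%:M : 'M[L{tau}]_m) c) 0 = c^T.
  by rewrite coefmx_combination coefmx_1 map_mx1 mulmx1.
have [|c [inn_c cP]] := bP (delta - combination h (1%:M : 'M[L{tau}]_m) u).
  by rewrite /Der0 coefmxB coef1 trmxK subrr.
exists (col_mx c u); split=> [|c'].
  by rewrite combination_constants col_mxKu col_mxKd opprD [- _ + _]addrC addrA.
rewrite combination_constants opprD [- _ + _]addrC addrA => inn.
have uE : u = dsubmx c'.
  have := inner_Der0 inn; rewrite /Der0 !coefmxB coef1 Db subr0.
  by move/eqP; rewrite subr_eq0 /u => /eqP->; rewrite trmxK.
by rewrite -[c']vsubmxK -uE (cP (usubmx c')) // uE.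
Qed.

(** As C_t = theta + tau, only the action of tau has to be found. With F expressing the rows tau b
    in the coordinates b, it is c |-> F(c^q), that is, F tau. The constant term of theta + F tau is
    theta, so a t-module results. *)
Lemma Ext1_exists k (b : 'M[L{tau}]_(k, m)) :
  coordinates Psi (@Der _ _ iota m) b -> exists E : tmodule iota k, is_Ext1 Psi E.
Proof.
move=> coord_b.
have [F FP] := coordinates_lift (b := (tau L_scal)%:M *m b)
  (b' := b) coord_b (fun _ _ _ => I).
pose T : 'M[L{tau}]_k := (tconst L_scal theta)%:M + F *m (tau L_scal)%:M.
have T0 : coefmx T 0 = theta%:M.
  rewrite coefmxD coefmxM big_ord1 coefmx_scalar_tau coefmx_scalar_const.
  by rewrite map_mx0 mulmx0 addr0.
exists (tmod_of T0); apply/tmod_structureP; exists b => // R h c.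
rewrite [tmod_of T0 'X](_ : _ = T); last exact: hornertX.
rewrite /T bcD bcM bc_tau scalar_tconst bc_const map_scalar_mx -scalar_tconst.
rewrite actmxDl actmx_scalar actmxM actmx_tau combinationD opprD addrA.
set c1 := map_mx _ c; have := FP R h c1; congr (inner Psi (_ - _)).
(* Moving tau past the coefficients: tau (c^T b) is the combination of the rows tau b with
   coefficients c^q. *)
apply: coefmxP => i; rewrite coefmxB coefmx_carlitzM !coefmx_combination coefmx_tauM.
rewrite linearZ -scalemxAl addrAC subrr add0r.
case: i => [|i]; first by rewrite map_mx0 mulmx0.
by rewrite coefmx_combination map_mxM map_frob_h map_trmx.
Qed.

Lemma Ext1_exact k0 k (E0 : tmodule iota k0) (E : tmodule iota k) :
    is_dual Psi E0 -> is_Ext1 Psi E ->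
  exists f g, short_exact E0 E (Ga iota m) f g.
Proof.
move=> /tmod_structureP[b0 coord_b0 act_b0] /tmod_structureP[b coord_b act_b].
have [f fP] := coordinates_lift (b := b0) (b' := b) coord_b (fun _ _ _ => I).
pose g := map_mx (tconst L_scal) (coefmx b 0)^T.
have gE (R : comNzRingType) (h : {rmorphism L -> R}) c :
    actmx (bc h g) c = (coefmx (combination h b c) 0)^T.
  by rewrite bc_const actmx_const coefmx_combination trmx_mul trmxK -map_trmx.
exists f, g; split.
- exact: coordinates_morphism fP.
- apply: actmx_faithful => R h c; rewrite !bcM !actmxM.
  rewrite [Ga iota m 'X](_ : _ = (tconst L_scal theta)%:M); last exact: hornertX.
  rewrite scalar_tconst bc_const map_scalar_mx actmx_const mul_scalar_mx !gE.
  (* The summand tau of C_t contributes nothing in degree 0, so t acts on constant terms through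
     theta alone. *)
  have := inner_Der0 (act_b R h c); rewrite /Der0 coefmxB => /eqP.
  by rewrite subr_eq0 => /eqP <-; rewrite coefmx_carlitzM addr0 linearZ.
move=> R h; have [Db0 b0P] := coord_b0 R h; have [_ bP] := coord_b R h; split.
- move=> u u' eq_f; apply: (coordinates_inj (h := h) coord_b0).
  by apply: inner_trans (fP _ _ _) _; rewrite eq_f; apply: inner_sym.
- move=> v; rewrite gE; split=> [v0|[u ->]].
    have [|u [inn_u _]] := b0P (combination h b v).
      by apply: trmx_inj; rewrite v0 trmx0.
    exists u; apply: (coordinates_inj (h := h) coord_b).
    exact: inner_trans inn_u (fP _ _ _).
  have := inner_Der0 (fP R h u); rewrite /Der0 coefmxB Db0 sub0r => /eqP.
  by rewrite oppr_eq0 => /eqP->; rewrite trmx0.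
(* The class of the constant biderivation w^T is a preimage of w. *)
move=> w; have [v [inn_v _]] := bP (map_mx (tconst (scalR iota h)) w^T) I.
exists v; rewrite gE; have := inner_Der0 inn_v; rewrite /Der0 coefmxB => /eqP.
by rewrite subr_eq0 coefmx_map_const => /eqP<-; rewrite trmxK.
Qed.

End NoNilpotence.

(** The constant terms of the two morphisms are mutually inverse matrices over L, and conjugation
    fixes the scalar matrix theta. *)
Lemma no_nilpotence_iso m m' (Psi : tmodule iota m) (Psi' : tmodule iota m') :
  tmod_iso Psi' Psi -> no_nilpotence Psi -> no_nilpotence Psi'.
Proof.
move=> [f [g [morf _ _ gf]]] nil; rewrite /no_nilpotence.
have coef0M a b c (A : 'M[L{tau}]_(a, b)) (B : 'M[L{tau}]_(b, c)) :
    coefmx (A *m B) 0 = coefmx A 0 *m coefmx B 0.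
  by rewrite coefmxM big_ord1 map_frob_0.
have gf0 : coefmx g 0 *m coefmx f 0 = 1%:M by rewrite -coef0M gf coefmx_1.
rewrite -[LHS]mul1mx -gf0 -mulmxA -coef0M morf coef0M nil.
by rewrite mul_scalar_mx -scalemxAr gf0 scalemx1.
Qed.

End Coordinates.

(** * Finitely supported sequences and block matrices *)

Definition finitely_supported (V : zmodType) (u : nat -> V) : Prop :=
  exists K, forall k, (K <= k)%N -> u k = 0.

Section Triangular.

Variables (V : zmodType) (T : (nat -> V) -> nat -> V) (s : nat) (l : nat -> V -> V).
Hypothesis TD : forall u v i, T (fun k => u k + v k) i = T u i + T v i.
Hypothesis T_high : forall K u, (forall k, (K <= k)%N -> u k = 0) ->
  forall i, (s + K <= i)%N -> T u i = 0.
Hypothesis T_top : forall K u, (forall k, (K < k)%N -> u k = 0) ->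
  T u (s + K)%N = l K (u K).

(** The entry at the top of the support is killed by [T_top], so the bound on the support descends
    to 0. *)
Lemma triangular_inj u : (forall K x, l K x = 0 -> x = 0) ->
  finitely_supported u -> (forall i, (s <= i)%N -> T u i = 0) ->
  forall k, u k = 0.
Proof.
move=> l_inj [K uK] Tu0; elim: K uK => [|K IHK] uK k; first exact: uK.
apply: IHK => {}k; rewrite leq_eqVlt => /predU1P[<-|]; last exact: uK.
by apply: (l_inj K); rewrite -(T_top uK) Tu0 ?leq_addr.
Qed.

(** The top entry of g is eliminated repeatedly by a sequence with a single nonzero term. Indices
    below s are left free: they will carry the coordinates. *)
Lemma triangular_surj g : (forall K y, exists x, l K x = y) ->
  finitely_supported g ->
  exists2 u, finitely_supported u & forall i, (s <= i)%N -> T u i = g i.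
Proof.
move=> l_surj [K0 gK0].
(* The bound is relaxed to s + K0 so that the induction on K0 ends with g zero from s on. *)
have : forall k, (s + K0 <= k)%N -> g k = 0.
  by move=> k le_k; apply: gK0; apply: leq_trans le_k; apply: leq_addl.
elim: K0 g {gK0} => [|K IHK] g gK.
  exists (fun=> 0); first by exists 0%N.
  by move=> i le_si; rewrite gK ?addn0 // (@T_high 0) ?addn0.
have [x lx] := l_surj K (g (s + K)%N).
pose e k := if k == K then x else 0.
have eK k : (K < k)%N -> e k = 0 by move=> ltKk; rewrite /e gtn_eqF.
have [|u [K' uK'] uP] := IHK (fun i => g i - T e i).
  move=> k; rewrite leq_eqVlt => /predU1P[<-|lt_k].
    by rewrite (T_top eK) /e eqxx lx subrr.
  by rewrite gK ?(T_high eK) ?subrr // addnS.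
exists (fun k => u k + e k).
  exists (maxn K' K.+1) => k; rewrite geq_max => /andP[/uK'-> /eK->].
  by rewrite addr0.
by move=> i le_si; rewrite TD uP // subrK.
Qed.

End Triangular.

Section Blocks.

Variables (d N' : nat).
Local Notation N := N'.+1.

(** Vectorization of d x N matrices serves as the bijection with pairs; the second index names the
    block. *)
Definition block_index (p : 'I_(d * N)) : 'I_d * 'I_N :=
  enum_val (cast_ord (esym (mxvec_cast d N)) p).

Lemma block_indexK i j : block_index (mxvec_index i j) = (i, j).
Proof. by rewrite /block_index /mxvec_index cast_ordK enum_rankK. Qed.

Variable R : comNzRingType.

Definition blk a (j : 'I_N) (A : 'M[R]_(a, d * N)) : 'M[R]_(a, d) :=
  \matrix_(r, i) A r (mxvec_index i j).

Definition unblk a (G : 'I_N -> 'M[R]_(a, d)) : 'M[R]_(a, d * N) :=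
  \matrix_(r, p) G (block_index p).2 r (block_index p).1.

Definition stack a (F : 'I_N -> 'M[R]_(d, a)) : 'M[R]_(d * N, a) :=
  \matrix_(p, r) F (block_index p).2 (block_index p).1 r.

Definition blocks (F : 'I_N -> 'I_N -> 'M[R]_d) : 'M[R]_(d * N) :=
  unblk (fun j' => stack (fun j => F j j')).

Lemma unblkK a G j : blk j (@unblk a G) = G j.
Proof. by apply/matrixP=> r i; rewrite !mxE block_indexK. Qed.

Lemma blkP a (A A' : 'M[R]_(a, d * N)) : (forall j, blk j A = blk j A') -> A = A'.
Proof.
move=> eqA; apply/matrixP=> r p; case/mxvec_indexP: p => i j.
by have /matrixP/(_ r i) := eqA j; rewrite !mxE.
Qed.

Lemma blk_is_zmod a j : zmod_morphism (@blk a j).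
Proof. by move=> A B; apply/matrixP=> r i; rewrite !mxE. Qed.

Lemma blkZ a j c (A : 'M[R]_(a, d * N)) : blk j (c *: A) = c *: blk j A.
Proof. by apply/matrixP=> r i; rewrite !mxE. Qed.

Lemma blk_mulmx a c j (A : 'M[R]_(a, c)) (X : 'M[R]_(c, d * N)) :
  blk j (A *m X) = A *m blk j X.
Proof. by apply/matrixP=> r i; rewrite !mxE; apply: eq_bigr => k _; rewrite mxE. Qed.

Lemma mul_stack a c (A : 'M[R]_(a, d * N)) (F : 'I_N -> 'M[R]_(d, c)) :
  A *m stack F = \sum_j blk j A *m F j.
Proof.
apply/matrixP=> r s; rewrite !mxE summxE (reindex _ (curry_mxvec_bij _ _)) /=.
under [RHS]eq_bigr => j _ do rewrite mxE.
rewrite exchange_big pair_bigA; apply: eq_bigr => -[i j] _ /=.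
by rewrite !mxE block_indexK.
Qed.

Lemma blk_blocks a (A : 'M[R]_(a, d * N)) F j' :
  blk j' (A *m blocks F) = \sum_j blk j A *m F j j'.
Proof. by rewrite blk_mulmx unblkK mul_stack. Qed.

Lemma tr_blocks F : (blocks F)^T = blocks (fun j j' => (F j' j)^T).
Proof. by apply/matrixP=> p r; rewrite !mxE. Qed.

End Blocks.

HB.instance Definition _ (d N' : nat) (R : comNzRingType) a j :=
  GRing.isZmodMorphism.Build _ _ (@blk d N' R a j) (@blk_is_zmod d N' R a j).

Lemma map_blocks d N' (R R' : comNzRingType) (f : R -> R') F :
  map_mx f (@blocks d N' R F) = blocks (fun j j' => map_mx f (F j j')).
Proof. by apply/matrixP=> p r; rewrite !mxE. Qed.

Lemma map_stack d N' a (R R' : comNzRingType) (f : R -> R') F :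
  map_mx f (@stack d N' R a F) = stack (fun j => map_mx f (F j)).
Proof. by apply/matrixP=> p r; rewrite !mxE. Qed.

Lemma map_unblk d N' a (R R' : comNzRingType) (f : R -> R') G :
  map_mx f (@unblk d N' R a G) = unblk (fun j => map_mx f (G j)).
Proof. by apply/matrixP=> p r; rewrite !mxE. Qed.

Lemma map_blk d N' a (R R' : comNzRingType) (f : R -> R') j A :
  blk j (map_mx f A) = map_mx f (@blk d N' R a j A).
Proof. by apply/matrixP=> p r; rewrite !mxE. Qed.

(** * Inner biderivations as finitely supported sequences of coefficients *)

Section InnerSequence.

Variables (Fq : finFieldType) (L : fieldType) (iota : {rmorphism {poly Fq} -> L}).
Local Notation q := #|Fq|.
Local Notation L_scal := (scal iota).
Local Notation "L{tau}" := (tpoly L_scal).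
Local Notation C_t := (carlitz iota 'X).
Local Notation theta := (iota 'X).

Lemma coordinatesI m k (Psi : tmodule iota m) (b : 'M[L{tau}]_(k, m)) D :
    (forall (R : comNzRingType) (h : {rmorphism L -> R}) c,
       D R h (combination h b c)) ->
    (forall (R : comNzRingType) (h : {rmorphism L -> R}) delta, D R h delta ->
       exists c, inner Psi (delta - combination h b c)) ->
    (forall (R : comNzRingType) (h : {rmorphism L -> R}) c,
       inner Psi (combination h b c) -> c = 0) ->
  coordinates Psi D b.
Proof.
move=> Db ex_c uniq_c R h; split=> // delta /ex_c[c inn_c].
exists c; split=> // c' /inner_sym inn_c'; apply/eqP; rewrite -subr_eq0.
apply/eqP/(uniq_c _ h); rewrite combinationB; apply: inner_sym.
exact: inner_trans inn_c' inn_c.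
Qed.

Section Sequence.

Variables (m : nat) (Psi : tmodule iota m).
Variables (R : comNzRingType) (h : {rmorphism L -> R}).
Local Notation sR := (scalR iota h).

(* tau^k A = (twist k A) tau^k over R. *)
Definition twist k a b (A : 'M[L]_(a, b)) : 'M[R]_(a, b) :=
  map_mx h (map_mx (frob L_scal k) A).

(** The coefficient of tau^i in U Psi_t - C_t U, for U = sum_k u_k tau^k. *)
Definition inner_coef (u : nat -> 'rV[R]_m) (i : nat) : 'rV[R]_m :=
  \sum_(k < i.+1) u k *m twist k (coefmx (Psi 'X) (i - k)) -
  (h theta *: u i + (if i is i'.+1 then map_mx (frob sR 1) (u i') else 0)).

Lemma innerP (delta : 'rV[tpoly sR]_m) :
  inner Psi delta <->
  exists2 u, finitely_supported u & forall i, coefmx delta i = inner_coef u i.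
Proof.
split=> [[U ->]|[u [K uK] deltaE]].
  exists (coefmx U) => [|i]; first exact: coefmx_finite.
  rewrite coefmxB coefmxM coefmx_carlitzM /inner_coef; congr (_ - _).
  by apply: eq_bigr => k _; rewrite coefmx_bc map_frob_h.
exists (mxofcoef _ u K); apply: coefmxP => i; rewrite deltaE.
have uE k : coefmx (mxofcoef sR u K) k = u k.
  by rewrite coefmx_mxofcoef; case: ltnP => // /uK.
rewrite coefmxB coefmxM coefmx_carlitzM /inner_coef uE; congr (_ - (_ + _)).
  by apply: eq_bigr => k _; rewrite coefmx_bc map_frob_h uE.
by case: i => // i; rewrite uE.
Qed.

Lemma inner_coefD u v i :
  inner_coef (fun k => u k + v k) i = inner_coef u i + inner_coef v i.
Proof.
rewrite /inner_coef addrACA -opprD addrACA -scalerDr -big_split; congr (_ - (_ + _)).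
  by apply: eq_bigr => k _; rewrite mulmxDl.
by case: i => [|i]; rewrite ?addr0 ?map_mxD.
Qed.

Lemma inner_coef0 u i : (forall k, u k = 0) -> inner_coef u i = 0.
Proof.
move=> u0; rewrite /inner_coef big1 => [|k _]; last by rewrite u0 mul0mx.
by rewrite u0 scaler0 !add0r; case: i => [|i]; rewrite ?u0 ?map_mx0 oppr0.
Qed.

Lemma inner_coef_0 u : no_nilpotence Psi -> inner_coef u 0 = 0.
Proof.
move=> nil; rewrite /inner_coef big_ord1 nil /twist map_frob_0 map_scalar_mx.
by rewrite mul_mx_scalar addr0 subrr.
Qed.

End Sequence.

End InnerSequence.

Section Twist.

Variables (Fq : finFieldType) (L : fieldType) (iota : {rmorphism {poly Fq} -> L}).
Variables (R : comNzRingType) (h : {rmorphism L -> R}).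
Local Notation q := #|Fq|.
Local Notation sR := (scalR iota h).
Local Notation twist := (twist iota h).

Lemma twist0 k a b : twist k (0 : 'M[L]_(a, b)) = 0.
Proof. by rewrite /twist !map_mx0. Qed.

Lemma twistB k a b (A B : 'M[L]_(a, b)) : twist k (A - B) = twist k A - twist k B.
Proof. by rewrite /twist !map_mxB. Qed.

Lemma twistM k a b c (A : 'M[L]_(a, b)) (B : 'M[L]_(b, c)) :
  twist k (A *m B) = twist k A *m twist k B.
Proof. by rewrite /twist !map_mxM. Qed.

Lemma twist_scalar k a x : twist k (x%:M : 'M[L]_a) = (h x ^+ (q ^ k))%:M.
Proof. by rewrite /twist !map_scalar_mx /= /frob rmorphXn. Qed.

Lemma twist_1 k a : twist k (1%:M : 'M[L]_a) = 1%:M.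
Proof. by rewrite twist_scalar rmorph1 expr1n. Qed.

Lemma twist_0 a b (A : 'M[L]_(a, b)) : twist 0 A = map_mx h A.
Proof. by rewrite /twist map_frob_0. Qed.

Lemma twist_frob k l a b (A : 'M[L]_(a, b)) :
  twist k (map_mx (frob (scal iota) l) A) = twist (k + l) A.
Proof. by rewrite /twist map_frob_frob. Qed.

Lemma frob_mul_twist k a b c (A : 'M[R]_(a, b)) (B : 'M[L]_(b, c)) :
  map_mx (frob sR 1) (A *m twist k B) = map_mx (frob sR 1) A *m twist k.+1 B.
Proof. by rewrite map_mxM map_frob_h map_frob_frob. Qed.

End Twist.

(** * The dual and the bidual *)

Section Dual.

Variables (Fq : finFieldType) (L : fieldType) (iota : {rmorphism {poly Fq} -> L}).
Local Notation q := #|Fq|.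
Local Notation L_scal := (scal iota).
Local Notation "L{tau}" := (tpoly L_scal).
Local Notation C_t := (carlitz iota 'X).
Local Notation theta := (iota 'X).

Variables (d N' : nat) (Phi : tmodule iota d).
Local Notation N := N'.+1.
Local Notation n := N.+1.
Local Notation M i := (coefmx (Phi 'X) i).

Hypothesis nil : no_nilpotence Phi.
Hypothesis Mn_unit : M n \in unitmx.
Hypothesis M_high : forall i, (n < i)%N -> M i = 0.

Definition select (j : nat) : 'M[L]_(d * N, d) :=
  stack (fun j' : 'I_N => (j' == inord j)%:R%:M).

(** Combinations of these rows are the normal forms c_1 tau + ... + c_{n-1} tau^{n-1}; block j holds
    the coefficient of tau^(j+1). *)
Definition dual_basis : 'M[L{tau}]_(d * N, d) :=
  mxofcoef L_scal (fun i => if i is j.+1 then select j else 0) n.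

Lemma coefmx_dual_combination (R : comNzRingType) (h : {rmorphism L -> R}) c i :
  coefmx (combination h dual_basis c) i =
  if (0 < i < n)%N then blk (inord i.-1) c^T else 0.
Proof.
rewrite coefmx_combination coefmx_mxofcoef.
case: i => [|i] /=; first by rewrite map_mx0 mulmx0.
case: ifP => _; last by rewrite map_mx0 mulmx0.
rewrite map_stack mul_stack (bigD1 (inord i)) //= big1 => [|j' /negPf->].
  by rewrite eqxx map_mx1 mulmx1 addr0.
by rewrite mulr0n raddf0 map_mx0 mulmx0.
Qed.

Section Triangularity.

Variables (R : comNzRingType) (h : {rmorphism L -> R}).
Local Notation sR := (scalR iota h).
Implicit Types u : nat -> 'rV[R]_d.

Lemma inner_coef_high K u : (forall k, (K <= k)%N -> u k = 0) ->
  forall i, (n + K <= i)%N -> inner_coef Phi h u i = 0.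
Proof.
move=> uK [|i] le_i; first by rewrite addSn in le_i.
have le_Ki : (K <= i)%N by rewrite -ltnS (leq_trans _ le_i) // addSn ltnS leq_addl.
rewrite /inner_coef !uK // 1?ltnW // scaler0 map_mx0 addr0 subr0.
apply: big1 => k _; have [/uK->|lt_kK] := leqP K k; first by rewrite mul0mx.
by rewrite M_high ?twist0 ?mulmx0 //; lia.
Qed.

(** In degree n + K, the product U Phi_t contributes only u_K times the twisted M_n, and C_t U, of
    degree at most K + 1, contributes nothing because n > 1. *)
Lemma inner_coef_top K u : (forall k, (K < k)%N -> u k = 0) ->
  inner_coef Phi h u (n + K) = u K *m twist iota h K (M n).
Proof.
move=> uK; rewrite /inner_coef addSn.
rewrite (uK (N + K)%N) ?(uK (N + K).+1); [|lia..].
rewrite scaler0 map_mx0 addr0 subr0.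
have lt_K : (K < (N + K).+2)%N by lia.
rewrite (bigD1 (Ordinal lt_K)) //= big1 => [|k neq_kK].
  by rewrite addr0 (_ : (_ - K)%N = n) //; lia.
have [lt_Kk|] := ltnP K k; first by rewrite uK ?mul0mx.
rewrite leq_eqVlt => /predU1P[eq_kK|lt_kK].
  by case/eqP: neq_kK; apply: val_inj.
by rewrite M_high ?twist0 ?mulmx0 //; lia.
Qed.

End Triangularity.

Lemma dual_coordinates : coordinates Phi (@Der0 _ _ iota d) dual_basis.
Proof.
have twist_unit (R : comNzRingType) (h : {rmorphism L -> R}) K :
    twist iota h K (invmx (M n)) *m twist iota h K (M n) = 1%:M.
  by rewrite -twistM mulVmx // twist_1.
have twist_unit' (R : comNzRingType) (h : {rmorphism L -> R}) K :
    twist iota h K (M n) *m twist iota h K (invmx (M n)) = 1%:M.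
  by rewrite -twistM mulmxV // twist_1.
apply: coordinatesI => R h.
- by move=> c; rewrite /Der0 coefmx_dual_combination.
- move=> delta delta0.
  have [||u u_fin uP] := triangular_surj
    (l := fun K x => x *m twist iota h K (M n)) (inner_coefD Phi h)
    (@inner_coef_high R h) (@inner_coef_top R h) (g := coefmx delta).
  + move=> K y; exists (y *m twist iota h K (invmx (M n))).
    by rewrite -mulmxA twist_unit mulmx1.
  + exact: coefmx_finite.
  (* The equations in degrees at least n determined U; what is left over in degrees 1 to n - 1 gives
     the coordinates. *)
  exists (unblk (fun j : 'I_N => coefmx delta j.+1 - inner_coef Phi h u j.+1))^T.
  apply/innerP; exists u => // i; rewrite coefmxB coefmx_dual_combination trmxK.
  case: i => [|i] /=; first by rewrite inner_coef_0 // subr0.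
  rewrite ltnS; case: ltnP => [lt_iN|le_Ni]; last by rewrite subr0 uP.
  by rewrite unblkK inordK // subKr.
move=> c /innerP[u u_fin uP].
have u0 : forall k, u k = 0.
  apply: (triangular_inj (l := fun K x => x *m twist iota h K (M n))
    (@inner_coef_top R h) (u := u)) => //.
  - move=> K x /(congr1 (mulmxr (twist iota h K (invmx (M n))))) /=.
    by rewrite -mulmxA twist_unit' mulmx1 mul0mx.
  - move=> i le_ni; rewrite -uP coefmx_dual_combination.
    by rewrite [X in _ && X]ltnNge le_ni andbF.
apply: trmx_inj; rewrite trmx0; apply: blkP => j; rewrite raddf0.
have := uP j.+1; rewrite inner_coef0 // coefmx_dual_combination /= ltnS ltn_ord.
by rewrite inord_val.
Qed.

(** Transposed because coordinates are columns while biderivations are rows. *)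
Definition dual_B : 'M[L]_d := (invmx (M n))^T.

(* Block j of a column is the coefficient c of tau^(j+1). In C_t times the
   normal form, the term of degree n is removed by subtracting the inner
   biderivation of U with U^T = dual_B tau c for the last block c. *)
Definition dual_coef1 (j j' : 'I_N) : 'M[L]_d :=
  (j == j'.+1 :> nat)%:R%:M -
  (if j' == ord_max then (M j.+1)^T *m dual_B else 0).

Definition dual_coef2 (j j' : 'I_N) : 'M[L]_d :=
  if (j == ord0) && (j' == ord_max) then map_mx (frob L_scal 1) dual_B else 0.

Definition dual_coef (i : nat) : 'M[L]_(d * N) :=
  match i with
  | 0%N => theta%:M
  | 1%N => blocks dual_coef1
  | 2%N => blocks dual_coef2
  | _ => 0
  end.

Definition dual_mx : 'M[L{tau}]_(d * N) := mxofcoef L_scal dual_coef 3.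

Lemma coefmx_dual_mx i : coefmx dual_mx i = dual_coef i.
Proof. by rewrite coefmx_mxofcoef; case: i => [|[|[|i]]]. Qed.

Definition dual_module : tmodule iota (d * N) := tmod_of (coefmx_dual_mx 0).

Lemma dual_moduleX : dual_module 'X = dual_mx.
Proof. exact: hornertX. Qed.

Lemma dual_no_nilpotence : no_nilpotence dual_module.
Proof. by rewrite /no_nilpotence dual_moduleX coefmx_dual_mx. Qed.

(** One block of the tau^2 coefficient is the Frobenius of [dual_B]. If it vanished, so would the
    inverse of M_n, which is impossible for d > 0. *)
Lemma tau_degree_dual : (0 < d)%N -> tau_degree dual_module = 2%N.
Proof.
move=> d_gt0; rewrite /tau_degree dual_moduleX; apply/eqP; rewrite eqn_leq.
apply/andP; split.
  apply/bigmax_leqP=> a _; apply/bigmax_leqP=> b _.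
  have : (sizet (dual_mx a b) <= 3)%N by rewrite mxE; apply: size_poly.
  by case: (sizet _).
rewrite leqNgt; apply/negP=> /tdeg_high; rewrite coefmx_dual_mx /= => dual2_0.
have : map_mx (frob L_scal 1) dual_B = 0.
  apply/matrixP=> a b; have /matrixP := dual2_0.
  move=> /(_ (mxvec_index a ord0) (mxvec_index b ord_max)).
  by rewrite !mxE !block_indexK /= /dual_coef2 !eqxx /= !mxE.
move=> frobB0; have B0 : invmx (M n) = 0.
  apply/matrixP=> a b; have /matrixP/(_ b a) := frobB0; rewrite !mxE /frob.
  by move/eqP; rewrite expf_eq0 => /andP[_ /eqP].
have := mulVmx Mn_unit; rewrite B0 mul0mx => /matrixP.
move=> /(_ (Ordinal d_gt0) (Ordinal d_gt0)); rewrite !mxE eqxx => /esym/eqP.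
by rewrite oner_eq0.
Qed.

Lemma actmx_dual (R : comNzRingType) (h : {rmorphism L -> R}) c :
  actmx (bc h dual_mx) c = h theta *: c +
    map_mx h (blocks dual_coef1) *m map_mx (frob (scalR iota h) 1) c +
    map_mx h (blocks dual_coef2) *m map_mx (frob (scalR iota h) 2) c.
Proof.
rewrite (@actmx_wide _ _ _ _ _ _ _ 3).
  rewrite 2!big_ord_recr big_ord1 /= !coefmx_bc !coefmx_dual_mx /=.
  by rewrite map_frob_0 map_scalar_mx mul_scalar_mx.
by case=> [|[|[|i]]] // _; rewrite coefmx_bc coefmx_dual_mx map_mx0.
Qed.

(** The t-action of the dual in row form: u is the constant row whose inner biderivation removes the
    term of degree n. *)
Lemma blk_actmx_dual (R : comNzRingType) (h : {rmorphism L -> R}) c (j : 'I_N) :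
  let u := map_mx (frob (scalR iota h) 1) (blk ord_max c^T)
             *m map_mx h (invmx (M n)) in
  blk j (actmx (bc h dual_mx) c)^T =
    h theta *: blk j c^T +
    (if j == 0%N :> nat then map_mx (frob (scalR iota h) 1) u
     else map_mx (frob (scalR iota h) 1) (blk (inord j.-1) c^T)) -
    u *m map_mx h (M j.+1).
Proof.
move=> u; rewrite actmx_dual 2!linearD /= !trmx_mul linearZ /= 2!raddfD /= blkZ.
rewrite !map_trmx !tr_blocks !map_blocks !blk_blocks -[LHS]addrA -[RHS]addrA.
congr (_ + _).
transitivity ((if j == 0%N :> nat then 0 else
     map_mx (frob (scalR iota h) 1) (blk (inord j.-1) c^T)) -
     u *m map_mx h (M j.+1) +
   if j == 0%N :> nat then map_mx (frob (scalR iota h) 1) u else 0); last first.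
  by rewrite addrAC; case: ifP; rewrite ?addr0 ?add0r.
congr (_ + _); last first.
  rewrite (bigD1 ord_max) //= big1 => [|j' /negPf nj']; last first.
    by rewrite /dual_coef2 nj' andbF trmx0 map_mx0 mulmx0.
  rewrite addr0 /dual_coef2 eqxx andbT -val_eqE /=; case: ifP => _.
    rewrite /u -(twist_0 iota h) frob_mul_twist map_frob_frob /twist map_trmx trmxK.
    by rewrite -map_blk.
  by rewrite trmx0 map_mx0 mulmx0.
rewrite /dual_coef1; under eq_bigr => j' _.
  rewrite linearB /= map_mxB mulmxBr; over.
rewrite sumrB; congr (_ - _).
  case: ifP => [/eqP j0|/negbT j_neq0].
    by rewrite big1 // => j' _; rewrite j0 /= mulr0n raddf0 trmx0 map_mx0 mulmx0.
  have j_lt := ltn_ord j; rewrite -lt0n in j_neq0.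
  have lt_j1 : (j.-1 < N)%N by rewrite (leq_ltn_trans (leq_pred _)).
  rewrite (bigD1 (inord j.-1)) //= big1 => [|j' nj'].
    by rewrite inordK // prednK // eqxx trmx1 map_mx1 mulmx1 addr0 map_blk.
  rewrite (_ : (_ == _) = false) ?mulr0n ?raddf0 ?trmx0 ?map_mx0 ?mulmx0 //.
  apply: contraNF nj' => /eqP jE; apply/eqP/val_inj; rewrite /= inordK // jE //.
rewrite (bigD1 ord_max) //= big1 => [|j' /negPf->].
  by rewrite eqxx addr0 /dual_B trmx_mul !trmxK map_mxM mulmxA map_blk.
by rewrite trmx0 map_mx0 mulmx0.
Qed.

Lemma dual_action : t_action Phi dual_basis dual_mx.
Proof.
move=> R h c; apply/innerP.
(* Chosen so that u0 M_n is the coefficient of tau^n in C_t times the combination. *)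
pose u0 := map_mx (frob (scalR iota h) 1) (blk ord_max c^T) *m map_mx h (invmx (M n)).
exists (fun k => if k == 0%N then u0 else 0); first by exists 1%N => -[].
move=> i; rewrite /inner_coef big_ord_recl big1 => [|k _]; last by rewrite mul0mx.
rewrite subn0 addr0 /= twist_0 coefmxB coefmx_carlitzM.
rewrite !coefmx_dual_combination; case: i => [|i].
  by rewrite nil map_scalar_mx mul_mx_scalar scaler0 !addr0 !subrr.
rewrite /= !scaler0 add0r coefmx_dual_combination.
case: (ltngtP i.+1 n) => [lt_in|gt_in|[->]].
- have lt_iN : (i < N)%N by rewrite -ltnS.
  rewrite blk_actmx_dual -/u0 inordK //.
  case: i lt_in lt_iN => [|i] /= _ _; last by rewrite subKr map_mx0 subr0.
  by rewrite map_mx0 addr0 -[X in _ - X = _]addrA opprD addrA subrr sub0r opprB.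
- have /negPf-> : i != 0%N by apply: contraTneq gt_in => ->.
  by rewrite M_high // andbF !map_mx0 scaler0 mulmx0 addr0.
rewrite (_ : inord N.-1 = ord_max) /=; last by apply: val_inj; rewrite /= inordK.
rewrite scaler0 add0r map_mx0 !subr0 /u0 -mulmxA -map_mxM mulVmx //.
by rewrite map_mx1 mulmx1.
Qed.

Lemma dual_module_is_dual : is_dual Phi dual_module.
Proof.
apply/tmod_structureP; exists dual_basis; first exact: dual_coordinates.
by rewrite dual_moduleX; apply: dual_action.
Qed.

(** * Inner biderivations of the dual, reduced to one unknown row *)

Section Bidual.

Variables (R : comNzRingType) (h : {rmorphism L -> R}).
Local Notation sR := (scalR iota h).
Local Notation frob1 := (map_mx (frob sR 1)).
Local Notation MT i k := (twist iota h k (M i)^T).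

Let twist_B k : twist iota h k dual_B *m MT n k = 1%:M.
Proof. by rewrite -twistM -trmx_mul mulmxV // trmx1 twist_1. Qed.

Let twist_B' k : MT n k *m twist iota h k dual_B = 1%:M.
Proof. by rewrite -twistM -trmx_mul mulVmx // trmx1 twist_1. Qed.

(** Right multiplication by tau, on coefficient sequences. *)
Definition delay (V : zmodType) (v : nat -> V) (k : nat) : V :=
  if k is k'.+1 then v k' else 0.

(* The coefficients of (tau V - [V, theta]) tau^-1 for V = sum_k v_k tau^k. *)
Definition shift_op (v : nat -> 'rV[R]_d) (k : nat) : 'rV[R]_d :=
  frob1 (v k) - (h theta ^+ (q ^ k.+1) - h theta) *: v k.+1.

(** For j < N - 1, block j of U Psi_t receives U_{j+1} tau. The last block collects the terms U_i
    M_{i+1}^T B tau and the tau^2 term of U_0; since tau B = B^(q) tau, the factor B twisted by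
    tau^k comes out of both. *)
Lemma blk_inner_coef_dual u (j : 'I_N) k :
  blk j (inner_coef dual_module h u k.+1) =
    (if j == ord_max then
       (delay (fun k => blk ord0 (u k)) k -
        \sum_(i < N) blk i (u k) *m MT i.+1 k) *m twist iota h k dual_B
     else blk (inord j.+1) (u k))
    - shift_op (fun k => blk j (u k)) k.
Proof.
rewrite /inner_coef dual_moduleX.
under eq_bigr => e _ do rewrite coefmx_dual_mx.
rewrite [in LHS]big_ord_recr [in LHS]big_ord_recr /= subnn subSnn /=.
rewrite raddfB 3!raddfD /= blkZ map_blk twist_scalar.
rewrite mul_mx_scalar blkZ /shift_op scalerBl.
have -> : blk j (u k *m twist iota h k (blocks dual_coef1)) =
    if j == ord_max then
      - (\sum_(i < N) blk i (u k) *m MT i.+1 k) *m twist iota h k dual_B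
    else blk (inord j.+1) (u k).
  rewrite /twist !map_blocks blk_blocks /dual_coef1.
  under eq_bigr => i _ do
    rewrite -[map_mx h _]/(twist iota h k _) twistB mulmxBr.
  rewrite sumrB; case: ifP => [/eqP->|/negbT j_neq_max].
    rewrite big1 => [|i _]; last first.
      by rewrite ltn_eqF // mulr0n raddf0 twist0 mulmx0.
    rewrite sub0r mulNmx mulmx_suml; congr (- _).
    by apply: eq_bigr => i _; rewrite twistM mulmxA.
  have lt_j1 : (j.+1 < N)%N.
    rewrite ltn_neqAle ltn_ord andbT; apply: contra j_neq_max => /eqP[jE].
    exact/eqP/val_inj.
  rewrite (bigD1 (inord j.+1)) //= inordK // eqxx twist_1 mulmx1 big1.
    by rewrite big1 ?addr0 ?subr0 // => i _; rewrite twist0 mulmx0.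
  move=> i /negPf neq_i; rewrite (_ : _ == _ = false) ?mulr0n ?raddf0 ?twist0 ?mulmx0 //.
  by rewrite -neq_i -val_eqE /= inordK.
have -> : blk j (\sum_(e < k) u e *m twist iota h e (dual_coef (k.+1 - e))) =
    if j == ord_max then
      delay (fun k => blk ord0 (u k)) k *m twist iota h k dual_B
    else 0.
  case: k => [|k] /=; first by rewrite big_ord0 raddf0 mul0mx if_same.
  rewrite big_ord_recr big1 => [|e _] /=; last first.
    have -> : (k.+2 - e = (k.-1 - e).+3)%N by have := ltn_ord e; lia.
    by rewrite twist0 mulmx0.
  rewrite add0r -addn2 addKn /= /twist !map_blocks blk_blocks /dual_coef2.
  under eq_bigr => i _ do rewrite -[map_mx h _]/(twist iota h k _).
  rewrite (bigD1 ord0) //= big1 => [|i /negPf->].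
    by rewrite addr0; case: ifP; rewrite ?twist0 ?mulmx0 ?twist_frob ?addn1.
  by rewrite twist0 mulmx0.
have shuffle (V : zmodType) (x t s f : V) : x + t - (s + f) = x - (f - (t - s)).
  by rewrite opprB addrA opprD -!addrA.
rewrite shuffle; congr (_ - _).
by case: ifP => _; rewrite ?add0r // mulmxBl mulNmx.
Qed.

(** Solves the block equations for U_1, U_2, ... starting from U_0 = v, where r holds the right-hand
    sides divided by tau. *)
Fixpoint propagate (r : nat -> nat -> 'rV[R]_d) (v : nat -> 'rV[R]_d) (j k : nat) :
    'rV[R]_d :=
  if j is j'.+1 then r j' k + shift_op (propagate r v j') k else v k.

(** The row U_N, with N = n - 1, is not a component of U: it is the value (U_0 tau - sum_{i<N} U_i
    M_{i+1}^T) B required by the last block. Multiplying that equation by M_n^T gives the vanishing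
    of the defect. *)
Definition defect (r : nat -> nat -> 'rV[R]_d) (v : nat -> 'rV[R]_d) (k : nat) :
    'rV[R]_d :=
  \sum_(j < n) propagate r v j k *m MT j.+1 k - delay v k.

Lemma shift_opD v1 v2 v3 :
  (forall k, v3 k = v1 k + v2 k) ->
  forall k, shift_op v3 k = shift_op v1 k + shift_op v2 k.
Proof.
by move=> vE k; rewrite /shift_op !vE map_mxD scalerDr opprD addrACA.
Qed.

Lemma propagateD r1 r2 r3 v1 v2 v3 :
    (forall j k, r3 j k = r1 j k + r2 j k) -> (forall k, v3 k = v1 k + v2 k) ->
  forall j k, propagate r3 v3 j k = propagate r1 v1 j k + propagate r2 v2 j k.
Proof.
move=> rE vE; elim=> [|j IHj] k //=.
by rewrite rE (shift_opD IHj) addrACA.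
Qed.

Lemma defectD r1 r2 r3 v1 v2 v3 :
    (forall j k, r3 j k = r1 j k + r2 j k) -> (forall k, v3 k = v1 k + v2 k) ->
  forall k, defect r3 v3 k = defect r1 v1 k + defect r2 v2 k.
Proof.
move=> rE vE k; rewrite /defect addrACA -opprD -big_split; congr (_ - _).
  by apply: eq_bigr => j _; rewrite (propagateD rE vE) mulmxDl.
by case: k => [|k] /=; rewrite ?addr0.
Qed.

Lemma shift_op_high K v : (forall k, (K <= k)%N -> v k = 0) ->
  forall k, (K <= k)%N -> shift_op v k = 0.
Proof.
move=> vK k le_k; rewrite /shift_op !vK ?(leq_trans le_k) //.
by rewrite map_mx0 scaler0 subr0.
Qed.

Lemma propagate_high K r v : (forall j k, (K <= k)%N -> r j k = 0) ->
    (forall k, (K <= k)%N -> v k = 0) ->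
  forall j k, (K <= k)%N -> propagate r v j k = 0.
Proof.
move=> rK vK; elim=> [|j IHj] k le_k /=; first exact: vK.
by rewrite rK // (shift_op_high IHj) // addr0.
Qed.

Lemma defect0 r v : (forall j k, r j k = 0) -> (forall k, v k = 0) ->
  forall k, defect r v k = 0.
Proof.
move=> r0 v0 k; rewrite /defect big1 => [|j _]; last first.
  by rewrite (@propagate_high 0) ?mul0mx.
by case: k => [|k] /=; rewrite ?v0 subr0.
Qed.

(** The coefficients of rho_j tau^-1, meaningful because rho will have zero constant term; the value
    for j >= N is a default. *)
Definition tau_coef (rho : 'rV[tpoly sR]_(d * N)) (j k : nat) : 'rV[R]_d :=
  if (j < N)%N then blk (inord j : 'I_N) (coefmx rho k.+1) else 0.

Lemma tau_coefE rho (j : 'I_N) k : tau_coef rho j k = blk j (coefmx rho k.+1).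
Proof. by rewrite /tau_coef ltn_ord inord_val. Qed.

Lemma inner_dualP (rho : 'rV[tpoly sR]_(d * N)) : Der0 rho ->
  inner dual_module rho <->
  exists2 v, finitely_supported v & forall k, defect (tau_coef rho) v k = 0.
Proof.
move=> rho0; split=> [/innerP[u [K uK] rhoE]|[v [K vK] v_def]].
  pose v k := blk (ord0 : 'I_N) (u k).
  exists v; first by exists K => k le_k; rewrite /v uK ?raddf0.
  have propE j k : (j < N)%N -> propagate (tau_coef rho) v j k = blk (inord j) (u k).
    elim: j k => [|j IHj] k lt_jN.
      by congr (blk _ _); apply: val_inj; rewrite /= inordK.
    have lt_j : (j < N)%N := ltnW lt_jN.
    rewrite /= /tau_coef lt_j rhoE blk_inner_coef_dual inordK //.
    have /negPf-> : inord j != ord_max :> 'I_N.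
      by rewrite -val_eqE /= inordK // ltn_eqF.
    by rewrite /shift_op !IHj // subrK.
  move=> k; rewrite /defect big_ord_recr /=.
  under eq_bigr => j _ do rewrite propE // inord_val.
  have maxE : inord N' = ord_max :> 'I_N by apply: val_inj; rewrite /= inordK.
  rewrite /tau_coef ltnSn rhoE blk_inner_coef_dual maxE eqxx /shift_op !propE //.
  rewrite maxE subrK.
  by rewrite -mulmxA twist_B mulmx1 addrC subrK subrr.
have [K' rhoK] := coefmx_finite rho.
(* Conversely, U is rebuilt from its block 0 by propagation. *)
apply/innerP; exists (fun k => unblk (fun j : 'I_N => propagate (tau_coef rho) v j k)).
  exists (maxn K K') => k le_k; apply: blkP => j; rewrite unblkK raddf0.
  apply: (@propagate_high (maxn K K')) => // [i l|l]; rewrite geq_max => /andP[le1 le2].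
    by rewrite /tau_coef rhoK ?raddf0 ?if_same // ltnW.
  exact: vK.
case=> [|k]; first by rewrite rho0 inner_coef_0 //; apply: dual_no_nilpotence.
apply: blkP => j; rewrite blk_inner_coef_dual.
have -> : shift_op (fun k => blk j
      (unblk (fun j : 'I_N => propagate (tau_coef rho) v j k))) k
    = shift_op (propagate (tau_coef rho) v j) k.
  by rewrite /shift_op !unblkK.
apply/eqP; rewrite -subr_eq; apply/eqP.
rewrite opprK.
have -> : blk j (coefmx rho k.+1) + shift_op (propagate (tau_coef rho) v j) k
    = propagate (tau_coef rho) v j.+1 k.
  by rewrite /= tau_coefE.
case: ifP => [/eqP->|/negbT j_neq_max].
  have := v_def k; rewrite /defect big_ord_recr /= => /eqP.
  rewrite addrAC addrC addr_eq0 opprB => /eqP defE.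
  have -> : delay (fun k => blk (ord0 : 'I_N)
      (unblk (fun j : 'I_N => propagate (tau_coef rho) v j k))) k = delay v k.
    by case: (k) => [|k'] //=; rewrite unblkK.
  under eq_bigr => i _ do rewrite unblkK.
  by rewrite -defE -mulmxA twist_B' mulmx1.
have lt_j1 : (j.+1 < N)%N.
  rewrite ltn_neqAle ltn_ord andbT; apply: contra j_neq_max => /eqP[jE].
  exact/eqP/val_inj.
by rewrite unblkK inordK.
Qed.

(** A right-hand side concentrated in the last block changes only U_N, hence enters the defect
    through M_n^T alone. *)
Lemma defect_delta k0 x k :
  defect (fun j k => if (j == N') && (k == k0) then x else 0) (fun=> 0) k =
  if k == k0 then x *m MT n k0 else 0.
Proof.
set r := fun j k => _; rewrite /defect.
have prop0 j l : (j <= N')%N -> propagate r (fun=> 0) j l = 0.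
  elim: j l => [|j IHj] l le_j //=.
  rewrite /r ltn_eqF //= add0r (@shift_op_high 0) // => i _.
  by apply: IHj; apply: ltnW.
rewrite big_ord_recr big1 => [|j _] /=; last by rewrite prop0 ?mul0mx // -ltnS.
rewrite (@shift_op_high 0 (propagate r _ N')) // => [|i _]; last exact: prop0.
rewrite /r eqxx addr0 add0r /= (_ : delay _ k = 0); last by case: (k).
by rewrite subr0; case: eqP => [->|_]; rewrite ?mul0mx.
Qed.

Lemma defect_high K v : (forall k, (K <= k)%N -> v k = 0) ->
  forall i, (1 + K <= i)%N -> - defect (fun _ _ => 0) v i = 0.
Proof.
move=> vK [|i] //= le_Ki; rewrite /defect big1 /= ?vK ?subr0 ?oppr0 // => j _.
by rewrite (propagate_high _ vK) ?mul0mx // ltnW.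
Qed.

(** Propagation does not raise the degree, so in degree K + 1 only the term V tau survives; the sign
    makes the leading coefficient 1. *)
Lemma defect_top K v : (forall k, (K < k)%N -> v k = 0) ->
  - defect (fun _ _ => 0) v (1 + K)%N = v K.
Proof.
move=> vK; rewrite /defect big1 ?sub0r ?opprK // => j _.
by rewrite (propagate_high _ vK) ?mul0mx.
Qed.

End Bidual.

(** The factor [dual_B] cancels the M_n^T of the defect, so that the defect of a combination is c^T
    in degree 0. With this normalization t acts by Phi_t itself, not by a conjugate. *)
Definition bidual_basis : 'M[L{tau}]_(d, d * N) :=
  mxofcoef L_scal (fun i => if i == 1%N then
    unblk (fun j : 'I_N => if j == ord_max then dual_B else 0) else 0) 2.

Lemma coefmx_bidual_combination (R : comNzRingType) (h : {rmorphism L -> R}) c i :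
  coefmx (combination h bidual_basis c) i = if i == 1%N then
    unblk (fun j : 'I_N => if j == ord_max then c^T *m map_mx h dual_B else 0)
  else 0.
Proof.
rewrite coefmx_combination coefmx_mxofcoef; case: eqP => [->|_] /=; last first.
  by rewrite if_same map_mx0 mulmx0.
rewrite map_unblk; apply: blkP => j; rewrite blk_mulmx !unblkK.
by case: ifP; rewrite ?map_mx0 ?mulmx0.
Qed.

Lemma tau_coef_bidual_combination (R : comNzRingType) (h : {rmorphism L -> R}) c j k :
  tau_coef (combination h bidual_basis c) j k =
  if (j == N') && (k == 0%N) then c^T *m map_mx h dual_B else 0.
Proof.
rewrite /tau_coef coefmx_bidual_combination eqSS.
case: ltnP => [lt_jN|le_Nj]; last by rewrite gtn_eqF.
case: (k == 0%N); last by rewrite raddf0 andbF.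
by rewrite unblkK andbT -val_eqE /= inordK.
Qed.

Lemma dual_B_unit (R : comNzRingType) (h : {rmorphism L -> R}) k :
  twist iota h k dual_B *m twist iota h k (M n)^T = 1%:M.
Proof. by rewrite -twistM -trmx_mul mulmxV // trmx1 twist_1. Qed.

Lemma defect_bidual (R : comNzRingType) (h : {rmorphism L -> R}) c k :
  defect h (tau_coef (combination h bidual_basis c)) (fun=> 0) k =
  if k == 0%N then c^T else 0.
Proof.
rewrite (@defectD R h (fun j k => if (j == N') && (k == 0%N) then
    c^T *m map_mx h dual_B else 0) (fun _ _ => 0) _ (fun=> 0) (fun=> 0)).
- rewrite defect_delta defect0 // addr0 -(twist_0 iota h) -mulmxA.
  by rewrite dual_B_unit mulmx1.
- by move=> j l; rewrite tau_coef_bidual_combination addr0.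
- by move=> l; rewrite addr0.
Qed.

Lemma bidual_coordinates :
  coordinates dual_module (@Der0 _ _ iota (d * N)) bidual_basis.
Proof.
have Db (R : comNzRingType) (h : {rmorphism L -> R}) c :
    Der0 (combination h bidual_basis c).
  by rewrite /Der0 coefmx_bidual_combination.
have defD (R : comNzRingType) (h : {rmorphism L -> R}) u v k :
    - defect h (fun _ _ => 0) (fun k => u k + v k) k =
    - defect h (fun _ _ => 0) u k + - defect h (fun _ _ => 0) v k.
  rewrite -opprD; congr (- _).
  by apply: defectD => // *; rewrite addr0.
apply: coordinatesI => // R h.
- move=> rho rho0; have [K rhoK] := coefmx_finite rho.
  have [||v v_fin vP] := triangular_surj (l := fun _ x => x) (defD R h)
    (@defect_high R h) (@defect_top R h) (g := defect h (tau_coef rho) (fun=> 0)).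
  + by move=> _ y; exists y.
  + exists K => k le_k; rewrite /defect big1 => [|j _]; last first.
      rewrite (@propagate_high R h K) ?mul0mx // => i l le_l.
      by rewrite /tau_coef rhoK ?raddf0 ?if_same // ltnW.
    by case: (k) => [|k'] /=; rewrite subrr.
  (* The row v removes the defect in all positive degrees; its value in degree 0 is the
     coordinate. *)
  pose w := defect h (tau_coef rho) v 0.
  have rho_0 : Der0 (rho - combination h bidual_basis w^T).
    by rewrite /Der0 coefmxB rho0 Db subrr.
  exists w^T; apply: (inner_dualP rho_0).2; exists v => // k.
  have defE : defect h (tau_coef rho) v k =
      defect h (tau_coef rho) (fun=> 0) k + defect h (fun _ _ => 0) v k.
    by apply: defectD => *; rewrite ?addr0 ?add0r.
  have := @defectD R h (tau_coef (rho - combination h bidual_basis w^T))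
    (tau_coef (combination h bidual_basis w^T)) (tau_coef rho) v (fun=> 0) v.
  move=> /(_ _ _ k)/esym/eqP; rewrite eq_sym -subr_eq defect_bidual trmxK.
  rewrite eq_sym => /(_ _ _)/eqP->.
  + by case: k defE => [|k] defE; rewrite ?subrr // subr0 defE -vP // addNr.
  + move=> j l; rewrite /tau_coef; case: ifP; rewrite ?addr0 // => _.
    by rewrite -raddfD coefmxB subrK.
  + by move=> l; rewrite addr0.
move=> c /(inner_dualP (Db _ _ _))[v v_fin v_def].
have defE k : defect h (tau_coef (combination h bidual_basis c)) v k =
    (if k == 0%N then c^T else 0) + defect h (fun _ _ => 0) v k.
  rewrite -(defect_bidual h c); apply: defectD => *; by rewrite ?addr0 ?add0r.
have v0 : forall k, v k = 0.
  apply: (triangular_inj (T := fun u i => - defect h (fun _ _ => 0) u i) (s := 1)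
    (l := fun _ x => x) (@defect_top R h) (u := v)) => //.
  move=> [|i] // _; apply/eqP; rewrite oppr_eq0.
  by have := v_def i.+1; rewrite defE /= add0r => ->.
apply: trmx_inj; rewrite trmx0; have := v_def 0%N.
by rewrite defE /= defect0 // addr0.
Qed.

Lemma bidual_action : t_action dual_module bidual_basis (Phi 'X).
Proof.
move=> R h c; set y := actmx _ _; set rho := _ - _.
have rho0 : Der0 rho.
  by rewrite /Der0 /rho coefmxB coefmx_carlitzM !coefmx_bidual_combination
             scaler0 addr0 subrr.
(* The constant row c^(q) cancels the defect of the tau^2 term of C_t times the combination. It
   propagates to U_j = c^(q^(j+1)), apart from [rho], and sum_j U_j M_{j+1}^T then supplies the
   non-constant part of Phi_t(c) in degree 0. *)
pose v k := if k == 0%N then map_mx (frob (scalR iota h) 1) c^T else 0.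
apply: (inner_dualP rho0).2; exists v; first by exists 1%N => -[].
pose delta x k0 (j k : nat) : 'rV[R]_d := if (j == N') && (k == k0) then x else 0.
pose x0 := h theta *: (c^T *m map_mx h dual_B) - y^T *m map_mx h dual_B.
pose x1 := map_mx (frob (scalR iota h) 1) (c^T *m map_mx h dual_B).
have rhoE j k : tau_coef rho j k = delta x0 0%N j k + delta x1 1%N j k.
  rewrite /tau_coef /delta; case: ltnP => [lt_jN|le_Nj]; last first.
    by rewrite gtn_eqF // addr0.
  have -> : (j == N') = ((inord j : 'I_N) == ord_max).
    by rewrite -val_eqE /= inordK.
  rewrite /rho coefmxB coefmx_carlitzM raddfB raddfD /= blkZ map_blk.
  rewrite !coefmx_bidual_combination.
  case: k => [|[|k]] /=.
  - rewrite !unblkK raddf0 map_mx0 andbF !addr0 andbT /x0.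
    by case: ifP; rewrite ?scaler0 ?subr0.
  - rewrite !unblkK !raddf0 addr0 andbF !add0r andbT.
    by case: ifP; rewrite ?map_mx0.
  by rewrite !raddf0 ?map_mx0 !andbF ?addr0 ?subr0.
move=> k.
rewrite (@defectD R h (delta x0 0%N) (delta x1 1%N) _ (fun=> 0) v) //;
  last by move=> l; rewrite add0r.
rewrite (@defectD R h (delta x1 1%N) (fun _ _ => 0) (delta x1 1%N) (fun=> 0) v v);
  first last.
- by move=> l; rewrite add0r.
- by move=> j l; rewrite addr0.
rewrite !defect_delta.
have propE j l : propagate h (fun _ _ => 0) v j l =
    if l == 0%N then map_mx (frob (scalR iota h) j.+1) c^T else 0.
  elim: j l => [|j IHj] l //=; rewrite add0r /shift_op !IHj scaler0 subr0.
  by case: ifP; rewrite ?map_mx0 ?map_frob_frob.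
rewrite /defect; under eq_bigr => j _ do rewrite propE.
case: k => [|[|k]] /=.
- have x0E : x0 *m twist iota h 0 (M n)^T = h theta *: c^T - y^T.
    by rewrite /x0 scalemxAl -mulmxBl -(twist_0 iota h) -mulmxA dual_B_unit mulmx1.
  have yE : y^T = h theta *: c^T +
      \sum_(i < n) map_mx (frob (scalR iota h) i.+1) c^T *m twist iota h 0 (M i.+1)^T.
    rewrite /y (@actmx_wide _ _ _ _ _ _ _ n.+1) => [|i lt_ni]; last first.
      by rewrite coefmx_bc M_high ?map_mx0.
    rewrite big_ord_recl linearD raddf_sum /= coefmx_bc nil map_frob_0.
    rewrite map_scalar_mx mul_scalar_mx linearZ; congr (_ + _).
    by apply: eq_bigr => i _; rewrite trmx_mul coefmx_bc twist_0 !map_trmx.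
  by rewrite subr0 add0r x0E yE opprD addrA subrr add0r addNr.
- rewrite big1 => [|i _]; last by rewrite mul0mx.
  rewrite !add0r /v /= /x1 -(twist_0 iota h) frob_mul_twist -mulmxA.
  by rewrite dual_B_unit mulmx1 subrr.
by rewrite big1 ?subr0 ?addr0 // => j _; rewrite mul0mx.
Qed.

Lemma bidual_is_dual : is_dual dual_module Phi.
Proof.
by apply/tmod_structureP; exists bidual_basis;
  [exact: bidual_coordinates | exact: bidual_action].
Qed.

End Dual.

Theorem theorem3p6 (Fq : finFieldType) (L : fieldType)
    (iota : {rmorphism {poly Fq} -> L}) (d n : nat) (Phi : tmodule iota d)
    (hd : (0 < d)%N) (hn : (1 < n)%N)
    (hpure : strictly_pure Phi) (hdeg : tau_degree Phi = n)
    (hnil : no_nilpotence Phi) :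
  (exists Phiv : tmodule iota (d * (n - 1)),
      is_dual Phi Phiv /\ tau_degree Phiv = 2%N) /\
  (forall Phiv : tmodule iota (d * (n - 1)), is_dual Phi Phiv ->
    [/\ exists Phivv : tmodule iota d, is_dual Phiv Phivv,
        forall (k : nat) (Phivv : tmodule iota k),
          is_dual Phiv Phivv -> tmod_iso Phivv Phi,
        exists E : tmodule iota (n * d), is_Ext1 Phiv E
      & forall E : tmodule iota (n * d), is_Ext1 Phiv E ->
          exists f g, short_exact Phi E (Ga iota ((n - 1) * d)) f g]).
Proof.
case: n hn hdeg => [|[|N']] // _ hdeg.
have Mn_unit : coefmx (Phi 'X) N'.+2 \in unitmx.
  by move: hpure; rewrite /strictly_pure hdeg.
have M_high i : (N'.+2 < i)%N -> coefmx (Phi 'X) i = 0.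
  by move=> lt_i; apply: tdeg_high; rewrite -/(tau_degree Phi) hdeg.
have dualP := dual_module_is_dual hnil Mn_unit M_high.
have bidualP := bidual_is_dual hnil Mn_unit M_high.
rewrite subSS subn0; split.
  by exists (dual_module N' Phi); split=> //; apply: tau_degree_dual.
move=> Phiv dualPhiv.
(* An arbitrary dual is isomorphic to the explicit one, along which no nilpotence and the
   computation of the bidual are transported. *)
have isoPhiv := tmod_structure_unique dualPhiv dualP.
have nilPhiv : no_nilpotence Phiv.
  by apply: no_nilpotence_iso isoPhiv _; apply: dual_no_nilpotence.
have dualPhivPhi : is_dual Phiv Phi := is_dual_iso isoPhiv bidualP.
split.
- by exists Phi.
- by move=> k Phivv dualPhivv; apply: tmod_structure_unique dualPhivv dualPhivPhi.
(* The d coordinates of the bidual are followed by d (n - 1) constant terms. *)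
- have -> : (N'.+2 * d = d + d * N'.+1)%N by rewrite mulSn mulnC.
  have [b coord_b _] := (tmod_structureP _ _ _).1 dualPhivPhi.
  exact: Ext1_exists (coordinates_constants nilPhiv coord_b).
by move=> E ExtE; rewrite [(N'.+1 * d)%N]mulnC; apply: (Ext1_exact nilPhiv dualPhivPhi).
Qed.
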